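(* Let $\pi\colon E\to M$ be a fiber bundle and $\pi^1\colon J^1\pi\to E$ the corresponding first-order jet bundle. The following elements can be canonically constructed one from the other: 1. A $\pi$-semibasic $1$-form $\nabla$ on $E$ with values in $\mathrm{T}E$, that is, an element of $\Gamma(E,\pi^*\mathrm{T}^*M)\otimes\Gamma(E,\mathrm{T}E)$, such that $\nabla^*\alpha=\alpha$ for every $\pi$-semibasic form $\alpha\in\Omega^1(E)$. 2. A subbundle $\mathrm{H}(\nabla)$ of $\mathrm{T}E$ such that $\mathrm{T}E=\mathrm{V}(\pi)\oplus\mathrm{H}(\nabla)$. 3. A (global) section of $\pi^1\colon J^1\pi\to E$, that is, a mapping $\Psi\colon E\to J^1\pi$ such that $\pi^1\circ\Psi=\mathrm{Id}_E$.
   Context: All manifolds are real, second countable and $C^\infty$; maps and structures are $C^\infty$. $\pi\colon E\to M$ is a differentiable fiber bundle. $\mathrm{V}(\pi)=\ker\mathrm{T}\pi\subset\mathrm{T}E$ is the vertical bundle of $\pi$. $J^1\pi$ is the bundle of $1$-jets of local sections of $\pi$: its fiber over $y\in E$, with $x=\pi(y)$, is the set of equivalence classes of local sections $\phi$ of $\pi$ with $\phi(x)=y$, two being equivalent when they have the same tangent map $\mathrm{T}_x\phi$ at $x$; $\pi^1\colon J^1\pi\to E$ is the natural projection. $\Gamma(E,\cdot)$ denotes the module of sections of a bundle over $E$, $\mathfrak{X}(E)$ the vector fields on $E$, and $\Omega^1(E)$ the $1$-forms on $E$. A form $\alpha\in\Omega^1(E)$ is $\pi$-semibasic if it is a section of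 $\pi^*\mathrm{T}^*M\subset\mathrm{T}^*E$, i.e. it vanishes on $\mathrm{V}(\pi)$. A $\pi$-semibasic $1$-form $\nabla$ with values in $\mathrm{T}E$ is regarded as a $C^\infty(E)$-linear map $\nabla\colon\mathfrak{X}(E)\to\mathfrak{X}(E)$ vanishing on vertical vector fields, and $\nabla^*\beta:=\beta\circ\nabla$ for $\beta\in\Omega^1(E)$. *)

(* Defs.v *)
From HB Require Import structures.
From mathcomp Require Import all_boot all_order all_algebra.
From mathcomp Require Import all_classical all_reals all_analysis.
Set Implicit Arguments.
Unset Strict Implicit.
Unset Printing Implicit Defensive.
Import Order.TTheory GRing.Theory Num.Theory numFieldNormedType.Exports.
Local Open Scope classical_set_scope.
Local Open Scope ring_scope.

(* All the iterated directional derivatives of f exist and are (Frechet)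
   differentiable at every point of U; for U open in a finite-dimensional space
   this is f being C^oo on U. *)
Definition smooth_on (R : realType) (V W : normedModType R) (U : set V)
    (f : V -> W) : Prop :=
  forall (vs : seq V) (x : V), U x ->
    differentiable (foldl (fun g v => 'D_v g) f vs) x.

(* cinv is only meaningful on the open set cmap @` cdom. *)
Record chart (R : realType) (T : topologicalType) (V : normedModType R) := Chart {
  cdom : set T;
  cmap :> T -> V;
  cinv : V -> T;
  cdom_open : open cdom;
  cimg_open : open (cmap @` cdom);
  cmapK : forall p, cdom p -> cinv (cmap p) = p;
  cmap_cont : forall p, cdom p -> {for p, continuous cmap};
  cinv_cont : forall p, cdom p -> {for cmap p, continuous cinv} }.

Record manifold (R : realType) (n : nat) := Manifold {
  carrier :> topologicalType;
  atlas : set (chart carrier 'rV[R]_n);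
  atlas_cover : forall p : carrier, exists2 c, atlas c & cdom c p;
  atlas_compat : forall c d, atlas c -> atlas d ->
    smooth_on (c @` (cdom c `&` cdom d)) (d \o cinv c);
  manifold_hausdorff : hausdorff_space carrier;
  manifold_second_countable : @second_countable carrier }.

Definition smooth_fun (R : realType) (T : topologicalType) (V W : normedModType R)
    (A : set (chart T V)) (U : set T) (f : T -> W) : Prop :=
  forall c, A c -> smooth_on (c @` (cdom c `&` U)) (f \o cinv c).

Definition smooth_map (R : realType) (T S : topologicalType)
    (V W : normedModType R) (A : set (chart T V)) (B : set (chart S W))
    (U : set T) (f : T -> S) : Prop :=
  (forall p, U p -> {for p, continuous f}) /\
  (forall d, B d -> smooth_fun A (U `&` f @^-1` cdom d) (d \o f)).

Arguments atlas {R n} m.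

Section Calculus.
Context {R : realType} {V : normedModType R}.

Definition diff_upto (W : normedModType R) k (U : set V) (f : V -> W) : Prop :=
  forall (vs : seq V) x, (size vs <= k)%N -> U x ->
    differentiable (foldl (fun g v => 'D_v g) f vs) x.

Lemma diff_uptoS (W : normedModType R) k U (f : V -> W) :
  diff_upto k.+1 U f <->
  (forall x, U x -> differentiable f x) /\
  (forall v, diff_upto k U ('D_v f)).
Proof.
split=> [H|[H0 H1]].
  by split=> [x Ux|v vs x s Ux]; [exact: (H [::])|exact: (H (v :: vs))].
by case=> [|v vs] x s Ux; [exact: H0|exact: H1].
Qed.

Lemma diff_upto_le (W : normedModType R) k U (f : V -> W) :
  diff_upto k.+1 U f -> diff_upto k U f.
Proof. by move=> H vs x s; apply: H; exact: leqW. Qed.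

Lemma eq_near_open (W : Type) U (f g : V -> W) x : open U -> U x ->
  (forall y, U y -> f y = g y) -> \forall y \near x, f y = g y.
Proof.
by move=> oU Ux fg; apply: filterS (open_nbhs_nbhs (conj oU Ux)); exact: fg.
Qed.

Lemma diff_near (W : normedModType R) (f g : V -> W) x :
  (\forall y \near x, f y = g y) -> differentiable g x -> differentiable f x.
Proof.
move=> fg dg; have fgx : f x = g x by exact: nbhs_singleton fg.
have /diff_locallyP[c e] := dg.
have fe : f \o shift x = cst (f x) + 'd g x +o_ 0 id.
  apply/eqaddoP => _/posnumP[eps].
  have /eqaddoP/(_ _ (gt0 eps)) := e.
  have fg0 : \forall y \near 0, f (y + x) = g (y + x).
    by move: fg; rewrite (near_shift 0 x) /= subr0.
  move: fg0; apply: filterS2 => y fgy.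
  by rewrite -![(_ - _) y]/(_ y - _ y) /= fgy fgx.
by apply/diff_locallyP; rewrite (diff_unique c fe); split.
Qed.

Lemma diff_upto_eq (W : normedModType R) k U (f g : V -> W) : open U ->
  (forall y, U y -> f y = g y) -> diff_upto k U g -> diff_upto k U f.
Proof.
move=> oU; elim: k f g => [|k IH] f g fg.
  move=> H [|//] x _ Ux; apply: diff_near (H [::] x isT Ux).
  exact: eq_near_open fg.
move=> /diff_uptoS[H0 H1]; apply/diff_uptoS; split=> [x Ux|v].
  by apply: diff_near (H0 x Ux); exact: eq_near_open fg.
apply: IH (H1 v) => y Uy; apply: near_eq_derive; exact: eq_near_open fg.
Qed.

Lemma diff_uptoD (W : normedModType R) k U (f g : V -> W) : open U ->
  diff_upto k U f -> diff_upto k U g -> diff_upto k U (f + g).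
Proof.
move=> oU; elim: k f g => [|k IH] f g.
  move=> Hf Hg [|//] x _ Ux.
  by apply: differentiableD; [exact: (Hf [::])|exact: (Hg [::])].
move=> /diff_uptoS[f0 f1] /diff_uptoS[g0 g1]; apply/diff_uptoS.
split=> [x Ux|v]; first by apply: differentiableD; [exact: f0|exact: g0].
apply: diff_upto_eq (IH _ _ (f1 v) (g1 v)) => // y Uy.
rewrite deriveD //; apply: diff_derivable; [exact: f0|exact: g0].
Qed.

Lemma scaler_bilinear (W : normedModType R) :
  bilinear_for (GRing.Scale.Law.clone _ _ *:%R _)
    (GRing.Scale.Law.clone _ _ *:%R _) ( *:%R : R^o -> W -> W).
Proof.
split=> [u'|u] a x y /=; first by rewrite scalerDl scalerA.
by rewrite scalerDr !scalerA mulrC.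
Qed.

Lemma diff_scaler (W : normedModType R) (f : V -> R^o) (g : V -> W) x :
  differentiable f x -> differentiable g x ->
  differentiable (fun y => f y *: g y) x /\
  forall v, 'D_v (fun y => f y *: g y) x = f x *: 'D_v g x + 'D_v f x *: g x.
Proof.
move=> df dg.
pose bM := bilinear_isBilinear.Build _ _ _ _ _ _ _ (@scaler_bilinear W).
pose b : {bilinear R^o -> W -> W} := HB.pack ( *:%R : R^o -> W -> W) bM.
have bc : continuous (fun p => b p.1 p.2) by exact: scale_continuous.
have db p : differentiable (fun p => b p.1 p.2) p by exact: differentiable_bilin.
have dp : differentiable (fun y => (f y, g y)) x by exact: differentiable_pair.
have e : (fun y => f y *: g y) = (fun p => b p.1 p.2) \o (fun y => (f y, g y)).
  by [].
have d : differentiable (fun y => f y *: g y) x.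
  by rewrite e; exact: differentiable_comp.
split=> // v.
by rewrite !deriveE// e diff_comp// diff_bilin// diff_pair.
Qed.

Lemma diff_uptoZ (W : normedModType R) k U (f : V -> R^o) (g : V -> W) : open U ->
  diff_upto k U f -> diff_upto k U g -> diff_upto k U (fun x => f x *: g x).
Proof.
move=> oU; elim: k f g => [|k IH] f g.
  move=> Hf Hg [|//] x _ Ux.
  by apply: (diff_scaler _ _).1; [exact: (Hf [::])|exact: (Hg [::])].
move=> Hf Hg; have /diff_uptoS[f0 f1] := Hf; have /diff_uptoS[g0 g1] := Hg.
apply/diff_uptoS; split=> [x Ux|v].
  by apply: (diff_scaler _ _).1; [exact: f0|exact: g0].
apply: diff_upto_eq (diff_uptoD oU (IH _ _ (diff_upto_le Hf) (g1 v))
  (IH _ _ (f1 v) (diff_upto_le Hg))) => // y Uy.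
by rewrite (diff_scaler _ _).2//; [exact: f0|exact: g0].
Qed.

Lemma smooth_on_upto (W : normedModType R) U (f : V -> W) :
  smooth_on U f <-> forall k, diff_upto k U f.
Proof. by split=> [H k vs x _|H vs x]; [exact: H|exact: (H (size vs))]. Qed.

Lemma smooth_onZD (W : normedModType R) U (f : V -> R^o) (g h : V -> W) :
  open U -> smooth_on U f -> smooth_on U g -> smooth_on U h ->
  smooth_on U (fun x => f x *: g x + h x).
Proof.
move=> oU /smooth_on_upto Hf /smooth_on_upto Hg /smooth_on_upto Hh.
by apply/smooth_on_upto => k; apply: diff_uptoD => //; exact: diff_uptoZ.
Qed.

End Calculus.

Lemma chart_img_open (R : realType) (T : topologicalType) (V : normedModType R)
  (c : chart T V) (U : set T) : open U -> open (c @` (cdom c `&` U)).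
Proof.
move=> oU; rewrite openE => _ [p [cp Up] <-].
have oI : nbhs (c p) (c @` cdom c).
  by apply: open_nbhs_nbhs; split; [exact: cimg_open|exists p].
have nU : nbhs (c p) (cinv c @^-1` U).
  by apply: (cinv_cont cp); rewrite cmapK //; exact: open_nbhs_nbhs.
apply: filterS2 oI nU => _ [q cq <-] /=; rewrite cmapK // => Uq.
by exists q.
Qed.

Section Tangent.
Context {R : realType} {n : nat}.
Implicit Type M : manifold R n.

Definition chart_at M (p : M) : chart M 'rV[R]_n :=
  projT1 (cid2 (atlas_cover p)).

Lemma chart_at_dom M (p : M) : cdom (chart_at p) p.
Proof. by rewrite /chart_at; case: cid2. Qed.

(* A tangent vector at p is recorded by its components in the chart chosen at p;
   tcoord c p turns them into the components in another chart c at p. *)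
Definition tangent M (p : M) : vectType R := 'rV[R]_n.

Definition tcoord M (c : chart M 'rV[R]_n) (p : M) (v : tangent p) : 'rV[R]_n :=
  'd (c \o cinv (chart_at p)) (chart_at p p) v.

(* The vector at p whose components in the chart c are a. *)
Definition tvec M (c : chart M 'rV[R]_n) (p : M) (a : 'rV[R]_n) : tangent p :=
  'd (chart_at p \o cinv c) (c p) a.

Definition smooth_section M (U : set M) (X : forall p : M, tangent p) : Prop :=
  forall c, atlas M c ->
    smooth_fun (atlas M) (U `&` cdom c) (fun p => tcoord c (X p)).

Record vector_field M := VectorField {
  vf_val :> forall p : M, tangent p;
  vf_smooth : smooth_section setT vf_val }.

Record smooth_function M := SmoothFunction {
  sf_val :> M -> R^o;
  sf_smooth : smooth_fun (atlas M) setT sf_val }.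

(* alpha is smooth when its coefficients alpha (d/dx^i) in the charts are. *)
Record one_form M := OneForm {
  form_val :> forall p : M, 'Hom(tangent p, R^o);
  form_smooth : forall c (a : 'rV[R]_n), atlas M c ->
    smooth_fun (atlas M) (cdom c) (fun p => form_val p (tvec c p a)) }.

Fact vf_lin_subproof M (f : smooth_function M) (X Y : vector_field M) :
  smooth_section setT (fun p => f p *: X p + Y p).
Proof.
move=> c ac d ad; rewrite setTI.
have sub Z (W : normedModType R) (g : _ -> W) :
    smooth_on (d @` (cdom d `&` Z)) g -> forall Z', Z' `<=` Z ->
    smooth_on (d @` (cdom d `&` Z')) g.
  by move=> H Z' ZZ vs _ [p [dp Zp] <-]; apply: H; exists p; split=> //; exact: ZZ.
have Hf : smooth_on (d @` (cdom d `&` cdom c)) (f \o cinv d).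
  by apply: sub (sf_smooth f ad) _ _.
have HX := vf_smooth X ac ad; have HY := vf_smooth Y ac ad.
rewrite setTI in HX; rewrite setTI in HY.
have := smooth_onZD (@chart_img_open _ _ _ d _ (cdom_open c)) Hf HX HY.
congr smooth_on; apply/funext => x /=.
by rewrite /tcoord linearP.
Qed.

Definition vf_lin M (f : smooth_function M) (X Y : vector_field M) :
  vector_field M := VectorField (vf_lin_subproof f X Y).

Definition is_subbundle M (H : forall p : M, {vspace tangent p}) : Prop :=
  forall p : M, exists (U : set M) (r : nat) (s : 'I_r -> forall q : M, tangent q),
    [/\ open U, U p, forall i, smooth_section U (s i) &
        forall q, U q -> basis_of (H q) (codom (fun i => s i q))].

End Tangent.

Definition tangent_map (R : realType) (n m : nat) (M : manifold R n)
    (N : manifold R m) (f : M -> N) (p : M) : 'Hom(tangent p, tangent (f p)) :=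
  linfun ('d (chart_at (f p) \o f \o cinv (chart_at p)) (chart_at p p)).

Lemma open_prod (T S : topologicalType) (A : set T) (B : set S) :
  open A -> open B -> open (A `*` B).
Proof.
move=> oA oB; rewrite openE => -[a b] [/= Aa Bb].
by exists (A, B) => //; split; exact: open_nbhs_nbhs.
Qed.

Section Product.
Context {R : realType} {T S : topologicalType} {V W : normedModType R}.
Variables (c : chart T V) (d : chart S W).

Let pdom : set (T * S) := cdom c `*` cdom d.
Let pmap (p : T * S) : V * W := (c p.1, d p.2).
Let pinv (v : V * W) : T * S := (cinv c v.1, cinv d v.2).

Fact prod_chart_dom : open pdom.
Proof. by apply: open_prod; exact: cdom_open. Qed.

Fact prod_chart_img : open (pmap @` pdom).
Proof.
have -> : pmap @` pdom = (c @` cdom c) `*` (d @` cdom d).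
  apply/seteqP; split=> [_ [p [p1 p2] <-]|[v w] [[p cp /= <-] [q dq /= <-]]].
    by split; [exists p.1|exists p.2].
  by exists (p, q).
by apply: open_prod; exact: cimg_open.
Qed.

Fact prod_chartK p : pdom p -> pinv (pmap p) = p.
Proof. by case: p => p q [cp dq]; rewrite /pinv /pmap /= !cmapK. Qed.

Fact prod_chart_cont p : pdom p -> {for p, continuous pmap}.
Proof.
case: p => p q [/= cp dq]; apply: cvg_pair.
  by apply: cvg_comp; [exact: cvg_fst|exact: (cmap_cont cp)].
by apply: cvg_comp; [exact: cvg_snd|exact: (cmap_cont dq)].
Qed.

Fact prod_chart_inv_cont p : pdom p -> {for pmap p, continuous pinv}.
Proof.
case: p => p q [/= cp dq]; apply: cvg_pair.
  by apply: cvg_comp; [exact: cvg_fst|exact: (cinv_cont cp)].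
by apply: cvg_comp; [exact: cvg_snd|exact: (cinv_cont dq)].
Qed.

Definition prod_chart : chart (T * S)%type (V * W)%type :=
  Chart prod_chart_dom prod_chart_img prod_chartK prod_chart_cont
    prod_chart_inv_cont.

End Product.

Definition prod_atlas (R : realType) (n m : nat) (M : manifold R n)
    (F : manifold R m) : set (chart (M * F)%type ('rV[R]_n * 'rV[R]_m)%type) :=
  [set prod_chart c d | c in atlas M & d in atlas F].

Arguments prod_atlas {R n m} M F.

(* A diffeomorphism (pi, triv_fib) from pi^-1(triv_dom) to triv_dom x F, with
   inverse triv_inv. *)
Record trivialization (R : realType) (n m k : nat) (M : manifold R n)
    (F : manifold R m) (E : manifold R k) (pi : E -> M) := Trivialization {
  triv_dom : set M;
  triv_fib : E -> F;
  triv_inv : M * F -> E;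
  triv_open : open triv_dom;
  triv_fib_smooth :
    smooth_map (atlas E) (atlas F) (pi @^-1` triv_dom) triv_fib;
  triv_inv_smooth :
    smooth_map (prod_atlas M F) (atlas E) (triv_dom `*` setT) triv_inv;
  triv_invK : forall y, triv_dom (pi y) -> triv_inv (pi y, triv_fib y) = y;
  triv_proj : forall x z, triv_dom x -> pi (triv_inv (x, z)) = x;
  triv_fibK : forall x z, triv_dom x -> triv_fib (triv_inv (x, z)) = z }.

Record fiber_bundle (R : realType) (n m k : nat) (M : manifold R n)
    (F : manifold R m) (E : manifold R k) := FiberBundle {
  fb_proj :> E -> M;
  fb_smooth : smooth_map (atlas E) (atlas M) setT fb_proj;
  fb_triv : forall x : M, exists t : trivialization F fb_proj, triv_dom t x }.

Section Connections.
Context {R : realType} {n m k : nat} {M : manifold R n} {F : manifold R m}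
  {E : manifold R k}.
Variable pi : fiber_bundle M F E.

Definition vertical (y : E) : {vspace tangent y} := lker (tangent_map pi y).

Definition semibasic (alpha : one_form E) : Prop :=
  forall (y : E) (v : tangent y), v \in vertical y -> alpha y v = 0.

(* TE-valued semibasic 1-forms, as C^oo(E)-linear operators on vector fields. *)
Record semibasic_form := SemibasicForm {
  sb_val :> vector_field E -> vector_field E;
  sb_linear : forall (f : smooth_function E) (X Y : vector_field E),
    sb_val (vf_lin f X Y) = vf_lin f (sb_val X) (sb_val Y);
  sb_vertical : forall X : vector_field E,
    (forall y, X y \in vertical y) -> forall y, sb_val X y = 0 }.

Definition form_eval (alpha : one_form E) (X : vector_field E) : E -> R :=
  fun y => alpha y (X y).

Definition form_pull (N : semibasic_form) (alpha : one_form E) :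
  vector_field E -> E -> R := form_eval alpha \o N.

Record connection_form := ConnectionForm {
  cf_val :> semibasic_form;
  cf_pull : forall alpha : one_form E, semibasic alpha ->
    form_pull cf_val alpha = form_eval alpha }.

Record horizontal_subbundle := HorizontalSubbundle {
  hs_val :> forall y : E, {vspace tangent y};
  hs_subbundle : is_subbundle hs_val;
  hs_direct : forall y, directv (vertical y + hs_val y);
  hs_full : forall y, (vertical y + hs_val y)%VS = fullv }.

Record local_section := LocalSection {
  ls_dom : set M;
  ls_val :> M -> E;
  ls_open : open ls_dom;
  ls_smooth : smooth_map (atlas M) (atlas E) ls_dom ls_val;
  ls_section : forall x, ls_dom x -> pi (ls_val x) = x }.

Definition jet_class (x : M) (phi : local_section) : set local_section :=
  [set psi | [/\ ls_dom psi x, psi x = phi x &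
    forall v : tangent x, tangent_map psi x v = tangent_map phi x v]].

(* The total space J^1 pi; jet_pt is the projection pi^1. *)
Record jet1 := Jet1 {
  jet_pt : E;
  jet_set : set local_section;
  jet_setP : exists phi : local_section,
    [/\ ls_dom phi (pi jet_pt), phi (pi jet_pt) = jet_pt &
        jet_set = jet_class (pi jet_pt) phi] }.

Definition jet_rep (j : jet1) : local_section := projT1 (cid (jet_setP j)).

(* The natural charts (x^i, y^a, y^a_i) of J^1 pi: they come from a local
   trivialization of pi with charts c of M and d of F, y^a_i being the partial
   derivatives at x of a section representing the jet. *)
Definition jet_dom (t : trivialization F pi) (c : chart M 'rV[R]_n)
    (d : chart F 'rV[R]_m) : set jet1 :=
  [set j | [/\ triv_dom t (pi (jet_pt j)), cdom c (pi (jet_pt j)) &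
    cdom d (triv_fib t (jet_pt j))]].

Definition jet_coord (t : trivialization F pi) (c : chart M 'rV[R]_n)
    (d : chart F 'rV[R]_m) (j : jet1) :
    ('rV[R]_n * 'rV[R]_m * 'M[R]_(n, m))%type :=
  let x := pi (jet_pt j) in
  (c x, d (triv_fib t (jet_pt j)),
   'J (d \o triv_fib t \o jet_rep j \o cinv c) (c x)).

(* For a section Psi of jet_pt the set Psi^-1(jet_dom t c d) is open in E, so that
   smoothness of Psi amounts to that of its components in the natural charts. *)
Record jet_section := JetSection {
  js_val :> E -> jet1;
  js_smooth : forall (t : trivialization F pi) c d, atlas M c -> atlas F d ->
    smooth_fun (atlas E) (js_val @^-1` jet_dom t c d)
      (jet_coord t c d \o js_val);
  js_section : jet_pt \o js_val = id }.

End Connections.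

(* Main.v *)
Require Import Defs.
From HB Require Import structures.
From mathcomp Require Import all_boot all_order all_algebra.
From mathcomp Require Import all_classical all_reals all_analysis.
From mathcomp Require Import ring.
Set Implicit Arguments.
Unset Strict Implicit.
Unset Printing Implicit Defensive.
Import Order.TTheory GRing.Theory Num.Theory numFieldNormedType.Exports.
Local Open Scope classical_set_scope.
Local Open Scope ring_scope.

(** Each of the three objects amounts to a smooth choice, for y in E, of a linear
right inverse of the projection T_y E -> T_(pi y) M, called a lifting below.
A horizontal subbundle H gives the inverse of the isomorphism from H_y onto
T_(pi y) M, and is the image of that lifting.  A connection form N gives the
map sending u to N v, for any v that projects to u, and is the composite of the
projection and that lifting.  A section of the jet bundle gives the
differentials of local sections that represent its jets, and a jet is
determined by its base point and this differential.  Each of the three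
constructions has an inverse; the six maps of the theorem are composites
through liftings, and they cancel for this reason alone.

At a single point all this is linear algebra.  The work lies in smoothness, and
in the fact that a connection form is only given on global vector fields.

Smoothness is checked in adapted coordinates, which a local trivialization
makes from charts of the base and of the fibre (local_coords_adapted).  There
the projection is (u, w) |-> u, so that a lifting is u |-> (u, u J) for a matrix
J; the entries of J are the natural coordinates of the corresponding jets
(jacobian_section), and conversely an affine map in these coordinates is a
local section with prescribed differential (exists_section).  For a subbundle
with local frame s, let P be the matrix of the projections of s: the lift of the
vector with components a is the combination of s with coefficients a P^-1,
which is smooth by Cramer's rule (horizontal_lift_smooth).

A connection form is linear over smooth functions, hence its value at a point
depends only on the value of the field at that point (tensor_pointwise).  This
uses bump functions (exists_bump), which are built from exp(-1/t) and need the
manifold to be Hausdorff.  Bump functions also extend a tangent vector to a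
global field, vertical everywhere if the vector is vertical (vf_extension), and
provide enough semibasic forms to see that N does not change the projection of
a vector (tangent_map_form). *)

(** * Smooth germs on normed spaces *)

Section SmoothAt.
Context {R : realType}.
Implicit Types V W Z : normedModType R.

(** Differentiability of the derivatives at the single point [x] would say nothing
about their existence nearby, hence the neighbourhood. *)
Definition smooth_at V W (f : V -> W) (x : V) : Prop :=
  \forall y \near x, smooth_on [set y] f.

Lemma near_open (T : topologicalType) (P : T -> Prop) (x : T) :
  (\forall y \near x, P y) <->
  exists U, [/\ open U, U x & forall y, U y -> P y].
Proof.
split=> [|[U [oU Ux UP]]]; last exact: filterS UP (open_nbhs_nbhs (conj oU Ux)).
move=> nP; have : nbhs x P by [].
by rewrite nbhsE => -[U [oU Ux] UP]; exists U.
Qed.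

Lemma smooth_at_open V W (f : V -> W) x :
  smooth_at f x <-> exists U, [/\ open U, U x & smooth_on U f].
Proof.
split=> [/near_open|] [U [oU Ux sU]].
  by exists U; split=> // vs y Uy; exact: (sU y).
by apply/near_open; exists U; split=> // y Uy vs _ ->; exact: sU.
Qed.

Lemma smooth_on_at V W (U : set V) (f : V -> W) : open U ->
  smooth_on U f <-> forall x, U x -> smooth_at f x.
Proof.
move=> oU; split=> [sU x Ux|sU vs x Ux]; first by apply/smooth_at_open; exists U.
by have /nbhs_singleton := sU x Ux; exact.
Qed.

Lemma smooth_at_near V W (f : V -> W) x :
  smooth_at f x -> \forall y \near x, smooth_at f y.
Proof. by move=> /near_join. Qed.

Lemma smooth_at_eq V W (f g : V -> W) x :
  (\forall y \near x, f y = g y) -> smooth_at g x -> smooth_at f x.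
Proof.
move=> /near_open[U [oU Ux fg]] /smooth_at_open[U' [oU' Ux' sg]].
apply/smooth_at_open; exists (U `&` U'); split=> //; first exact: openI.
apply/smooth_on_upto => k; apply: (diff_upto_eq (g := g)); first exact: openI.
  by move=> y [/fg].
by move=> vs y _ [_ Uy]; exact: sg.
Qed.

Lemma smooth_at_ext V W (f g : V -> W) x :
  f =1 g -> smooth_at g x -> smooth_at f x.
Proof. by move=> fg; apply: smooth_at_eq; exact: nearW. Qed.

Lemma smooth_at_diff V W (f : V -> W) x : smooth_at f x -> differentiable f x.
Proof. by move=> /nbhs_singleton/(_ [::] x erefl). Qed.

Lemma smooth_at_continuous V W (f : V -> W) x :
  smooth_at f x -> {for x, continuous f}.
Proof. by move=> /smooth_at_diff/differentiable_continuous. Qed.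

Lemma smooth_at_derive V W (f : V -> W) v x :
  smooth_at f x -> smooth_at ('D_v f) x.
Proof. by apply: filterS => y H vs; apply: (H (v :: vs)). Qed.

Lemma smooth_atZD V W (f : V -> R^o) (g h : V -> W) x :
  smooth_at f x -> smooth_at g x -> smooth_at h x ->
  smooth_at (fun y => f y *: g y + h y) x.
Proof.
move=> /smooth_at_open[A [oA Ax sA]] /smooth_at_open[B [oB Bx sB]].
move=> /smooth_at_open[C [oC Cx sC]]; apply/smooth_at_open.
exists (A `&` B `&` C); split=> //; first by do 2?apply: openI.
apply: smooth_onZD; first (by do 2?apply: openI); move=> vs y [[? ?] ?].
- exact: sA.
- exact: sB.
- exact: sC.
Qed.

Lemma diff_upto_cst V W k (U : set V) (a : W) : diff_upto k U (cst a).
Proof.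
elim: k U a => [|k IH] U a; first by case=> [|//] x _ _; exact: differentiable_cst.
apply/diff_uptoS; split=> [x _|v]; first exact: differentiable_cst.
have -> : 'D_v (cst a) = cst (0 : W) by apply/funext => y; rewrite derive_cst.
exact: IH.
Qed.

Lemma smooth_at_cst V W (a : W) (x : V) : smooth_at (fun _ => a) x.
Proof. by apply: nearW => y; apply/smooth_on_upto => k; exact: diff_upto_cst. Qed.

Lemma smooth_atZ V W (f : V -> R^o) (g : V -> W) x :
  smooth_at f x -> smooth_at g x -> smooth_at (fun y => f y *: g y) x.
Proof.
move=> sf sg; have := smooth_atZD sf sg (smooth_at_cst 0 x).
by apply: smooth_at_ext => y; rewrite addr0.
Qed.

Lemma smooth_atD V W (f g : V -> W) x :
  smooth_at f x -> smooth_at g x -> smooth_at (fun y => f y + g y) x.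
Proof.
move=> sf sg; have := smooth_atZD (smooth_at_cst (1 : R^o) x) sf sg.
by apply: smooth_at_ext => y; rewrite scale1r.
Qed.

Lemma smooth_atM V (f g : V -> R^o) x :
  smooth_at f x -> smooth_at g x -> smooth_at (fun y => f y * g y : R^o) x.
Proof. exact: smooth_atZ. Qed.

Lemma smooth_at_sum V W (I : Type) (r : seq I) (P : pred I) (f : I -> V -> W) x :
  (forall i, P i -> smooth_at (f i) x) ->
  smooth_at (fun y => \sum_(i <- r | P i) f i y) x.
Proof.
move=> sf; elim: r => [|i r IH].
  by apply: smooth_at_ext (smooth_at_cst 0 x) => y; rewrite big_nil.
case: (boolP (P i)) => Pi; last first.
  by apply: smooth_at_ext IH => y; rewrite big_cons (negbTE Pi).
apply: smooth_at_ext (smooth_atD (sf i Pi) IH) => y.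
by rewrite big_cons Pi.
Qed.

Lemma smooth_at_prod V (I : Type) (r : seq I) (P : pred I) (f : I -> V -> R^o) x :
  (forall i, P i -> smooth_at (f i) x) ->
  smooth_at (fun y => \prod_(i <- r | P i) (f i y : R) : R^o) x.
Proof.
move=> sf; elim: r => [|i r IH].
  by apply: smooth_at_ext (smooth_at_cst (1 : R^o) x) => y; rewrite big_nil.
case: (boolP (P i)) => Pi; last first.
  by apply: smooth_at_ext IH => y; rewrite big_cons (negbTE Pi).
apply: smooth_at_ext (smooth_atM (sf i Pi) IH) => y.
by rewrite big_cons Pi.
Qed.

Lemma diff_upto_linear V W Z k (U : set V) (f : V -> W) (L : W -> Z) :
  open U -> linear L -> continuous L -> diff_upto k U f ->
  diff_upto k U (fun y => L (f y)).
Proof.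
move=> oU linL cL.
pose LL : {linear W -> Z} := HB.pack L (GRing.isLinear.Build _ _ _ _ L linL).
have dL w : differentiable L w by exact: (@linear_differentiable _ _ _ LL).
elim: k f => [|k IH] f.
  move=> H [|//] x _ Ux; apply: (@differentiable_comp _ _ _ _ f L) => //.
  exact: (H [::]).
move=> /diff_uptoS[f0 f1]; apply/diff_uptoS; split=> [x Ux|v].
  by apply: (@differentiable_comp _ _ _ _ f L) => //; exact: f0.
apply: diff_upto_eq (IH _ (f1 v)) => // y Uy.
have d : differentiable (fun y => L (f y)) y.
  exact: (@differentiable_comp _ _ _ _ f L _ (f0 y Uy) (dL (f y))).
rewrite (deriveE _ d) (deriveE _ (f0 y Uy)).
rewrite (@diff_comp _ _ _ _ f L _ (f0 y Uy) (dL _)) /=.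
by rewrite (diff_lin (f := LL) _ cL).
Qed.

Lemma smooth_at_linear V W Z (f : V -> W) (L : W -> Z) x :
  linear L -> continuous L -> smooth_at f x -> smooth_at (fun y => L (f y)) x.
Proof.
move=> linL cL /smooth_at_open[U [oU Ux sU]]; apply/smooth_at_open; exists U.
split=> //; apply/smooth_on_upto => k; apply: diff_upto_linear => //.
by move: k; apply/smooth_on_upto.
Qed.

(** Continuous linear coordinates. The chain rule needs them to write the
differential of a composite with directional derivatives along fixed vectors. *)
Definition findim W : Prop := exists (I : finType) (e : I -> W)
  (x : I -> W -> R^o),
  [/\ forall i, linear (x i), forall i, continuous (x i) &
      forall w, w = \sum_i x i w *: e i].

Lemma diff_upto_sum V W (I : Type) (r : seq I) (f : I -> V -> W) k U : open U ->
  (forall i, diff_upto k U (f i)) ->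
  diff_upto k U (fun y => \sum_(i <- r) f i y).
Proof.
move=> oU sf; elim: r => [|i r IH].
  apply: (diff_upto_eq (g := cst 0)) => //; last exact: diff_upto_cst.
  by move=> y _; rewrite big_nil.
apply: diff_upto_eq (diff_uptoD oU (sf i) IH) => // y _.
by rewrite big_cons.
Qed.

(** In coordinates of W, the derivative of [g \o f] along v is the sum of the
products of [x i ('D_v f)] and ['D_(e i) g \o f]; the induction on k applies to
both factors. *)
Lemma diff_upto_comp V W Z k (U : set V) (U' : set W) (f : V -> W) (g : W -> Z) :
  findim W -> open U -> (forall x, U x -> U' (f x)) ->
  diff_upto k U f -> diff_upto k U' g -> diff_upto k U (g \o f).
Proof.
move=> [I [e [x [lx cx ex]]]] oU UU'; elim: k f g UU' => [|k IH] f g UU'.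
  move=> H H' [|//] y _ Uy; apply: differentiable_comp; first exact: (H [::]).
  by apply: (H' [::]) => //; exact: UU'.
move=> Hf; have /diff_uptoS[f0 f1] := Hf; move=> /diff_uptoS[g0 g1].
apply/diff_uptoS; split=> [y Uy|v].
  by apply: differentiable_comp; [exact: f0|exact/g0/UU'].
apply: (diff_upto_eq (g := fun y =>
    \sum_i (x i ('D_v f y)) *: ('D_(e i) g \o f) y)) => //.
  move=> y Uy; have dg := g0 _ (UU' y Uy).
  have d := differentiable_comp (f0 y Uy) dg.
  rewrite (deriveE _ d) /= (diff_comp (f0 y Uy) dg) /= -(deriveE _ (f0 y Uy)).
  rewrite {1}[X in 'd g _ X]ex linear_sum; apply: eq_bigr => i _.
  by rewrite linearZ /= (deriveE _ dg).
apply: diff_upto_sum => // i; apply: diff_uptoZ => //.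
  exact: diff_upto_linear.
by apply: IH => //; exact: diff_upto_le.
Qed.

Lemma smooth_at_comp V W Z (f : V -> W) (g : W -> Z) x : findim W ->
  smooth_at f x -> smooth_at g (f x) -> smooth_at (g \o f) x.
Proof.
move=> fW sf; have cf := smooth_at_continuous sf.
case/smooth_at_open: sf => U [oU Ux sU] /smooth_at_open[U' [oU' Ux' sU']].
have : nbhs x (U `&` f @^-1` U').
  apply: filterI; first exact: open_nbhs_nbhs.
  by apply: cf; exact: open_nbhs_nbhs.
move=> /near_open[A [oA Ax sA]]; apply/smooth_at_open; exists A; split=> //.
apply/smooth_on_upto => k; apply: (diff_upto_comp (U' := U')) => //.
- by move=> y /sA[].
- by move=> vs y _ /sA[Uy _]; exact: sU.
- by move: k; apply/smooth_on_upto.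
Qed.

Lemma smooth_at_coord V W (I : finType) (e : I -> W) (f : I -> V -> R^o) x :
  (forall i, smooth_at (f i) x) -> smooth_at (fun y => \sum_i f i y *: e i) x.
Proof.
by move=> sf; apply: smooth_at_sum => i _; apply: smooth_atZ => //; exact: smooth_at_cst.
Qed.

(** In coordinates of W the value is a sum of products of coordinates of w with
partial derivatives of g along c. *)
Lemma smooth_at_diff_app V W Z (g : W -> Z) (c w : V -> W) x : findim W ->
  smooth_at g (c x) -> smooth_at c x -> smooth_at w x ->
  smooth_at (fun y => 'd g (c y) (w y)) x.
Proof.
move=> fW; have [I [e [xi [lx cx ex]]]] := fW => sg sc sw.
have : smooth_at (fun y => \sum_i (xi i (w y)) *: ('D_(e i) g \o c) y) x.
  apply: smooth_at_sum => i _; apply: smooth_atZ.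
    exact: smooth_at_linear.
  by apply: smooth_at_comp => //; exact: smooth_at_derive.
apply: smooth_at_eq.
have : \forall y \near x, smooth_at g (c y).
  by apply: (smooth_at_continuous sc); exact: smooth_at_near.
apply: filterS => y /smooth_at_diff dg.
rewrite {1}[X in 'd g _ X](ex (w y)) linear_sum; apply: eq_bigr => i _.
by rewrite linearZ /= (deriveE _ dg).
Qed.

Lemma smooth_at_id V (x : V) : smooth_at id x.
Proof.
have d (z : V) : differentiable (id : V -> V) z.
  by apply: ex_diff; exact: is_diff_id.
apply: nearW => y; apply/smooth_on_upto; case=> [|k].
  by case=> [|//] z _ _; exact: d.
apply/diff_uptoS; split=> [z _|v]; first exact: d.
have -> : 'D_v (id : V -> V) = cst v by apply/funext => z; rewrite derive_id.
exact: diff_upto_cst.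
Qed.

Lemma smooth_at_lin V W (L : V -> W) x :
  linear L -> continuous L -> smooth_at L x.
Proof. by move=> lL cL; exact: (smooth_at_linear lL cL (smooth_at_id x)). Qed.

End SmoothAt.

(** * Products, matrices and inverses *)

Section Targets.
Context {R : realType}.
Implicit Types V W Z : normedModType R.

Lemma findim_mx m n : findim 'M[R]_(m, n).
Proof.
exists ('I_m * 'I_n)%type, (fun p => delta_mx p.1 p.2),
  (fun p (A : 'M[R]_(m, n)) => A p.1 p.2 : R^o).
split=> [p a A B|p|A]; first by rewrite !mxE.
  exact: coord_continuous.
by rewrite {1}[A]matrix_sum_delta pair_bigA.
Qed.

Lemma findim_scalar : findim R^o.
Proof.
exists unit, (fun _ => 1 : R^o), (fun _ x => x).
split=> [i a x y|i x|w] //.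
by rewrite big_const card_unit /= addr0 /GRing.scale /= mulr1.
Qed.

Lemma findim_prod V W : findim V -> findim W -> findim (V * W)%type.
Proof.
move=> [I [e [x [lx cx ex]]]] [J [f [y [ly cy ey]]]].
exists (I + J)%type, (fun i => match i with inl i => (e i, 0) | inr j => (0, f j) end),
  (fun i p => match i with inl i => x i p.1 | inr j => y j p.2 end).
split=> [[i|j] a p q|[i|j] p|[v w]] /=; rewrite ?lx ?ly //.
- by apply: (continuous_comp _ (cx i _)); exact: cvg_fst.
- by apply: (continuous_comp _ (cy j _)); exact: cvg_snd.
rewrite big_sumType /= [RHS]surjective_pairing; congr pair.
- rewrite raddfD /= !(raddf_sum fst) /= [X in _ + X]big1 ?addr0; last first.
    by move=> j _; rewrite scaler0.
  exact: ex.
- rewrite raddfD /= !(raddf_sum snd) /= [X in X + _]big1 ?add0r; last first.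
    by move=> j _; rewrite scaler0.
  exact: ey.
Qed.

Lemma smooth_at_snd V W Z (f : V -> W * Z) x :
  smooth_at f x -> smooth_at (fun y => (f y).2) x.
Proof.
by apply: (smooth_at_linear (L := snd)) => [a p q|p] //; exact: cvg_snd.
Qed.

Lemma smooth_at_pair V W Z (f : V -> W) (g : V -> Z) x :
  smooth_at f x -> smooth_at g x -> smooth_at (fun y => (f y, g y)) x.
Proof.
move=> sf sg.
have s1 : smooth_at (fun y => (f y, 0 : Z)) x.
  apply: (smooth_at_linear (L := fun w => (w, 0 : Z))) => // [a p q|p].
    by congr pair; rewrite /= scaler0 addr0.
  by apply: cvg_pair; [exact: cvg_id|exact: cvg_cst].
have s2 : smooth_at (fun y => (0 : W, g y)) x.
  apply: (smooth_at_linear (L := fun w => (0 : W, w))) => // [a p q|p].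
    by congr pair; rewrite /= scaler0 addr0.
  by apply: cvg_pair; [exact: cvg_cst|exact: cvg_id].
apply: smooth_at_ext (smooth_atD s1 s2) => y.
by congr pair; rewrite /= ?addr0 ?add0r.
Qed.

Lemma smooth_at_entry V m n (f : V -> 'M[R]_(m, n)) i j x :
  smooth_at f x -> smooth_at (fun y => f y i j : R^o) x.
Proof.
apply: (smooth_at_linear (L := fun A : 'M[R]_(m, n) => A i j : R^o)).
  by move=> a A B; rewrite !mxE.
exact: coord_continuous.
Qed.

Lemma smooth_at_mx V m n (f : V -> 'M[R]_(m, n)) x :
  (forall i j, smooth_at (fun y => f y i j : R^o) x) -> smooth_at f x.
Proof.
move=> sf; have : smooth_at (fun y => \sum_(p : 'I_m * 'I_n)
    (f y p.1 p.2 : R^o) *: (delta_mx p.1 p.2 : 'M[R]_(m, n))) x.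
  by apply: smooth_at_coord => p; exact: sf.
apply: smooth_at_ext => y.
by rewrite {1}[f y]matrix_sum_delta pair_bigA.
Qed.

Lemma smooth_at_mulmx V a b e (f : V -> 'M[R]_(a, b)) (g : V -> 'M[R]_(b, e)) x :
  smooth_at f x -> smooth_at g x -> smooth_at (fun y => f y *m g y) x.
Proof.
move=> sf sg; apply: smooth_at_mx => i j.
have : smooth_at (fun y => \sum_k (f y i k : R^o) *: (g y k j : R^o) : R^o) x.
  by apply: smooth_at_sum => l _; apply: smooth_atZ; exact: smooth_at_entry.
by apply: smooth_at_ext => y; rewrite mxE.
Qed.

(** The derivative of 1/f is -(1/f)^2 'D_v f, in which 1/f is differentiated one
time less. *)
Lemma diff_uptoV V k (U : set V) (f : V -> R^o) : open U ->
  (forall y, U y -> f y != 0) -> diff_upto k U f ->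
  diff_upto k U (fun y => (f y)^-1 : R^o).
Proof.
move=> oU f0; elim: k => [|k IH].
  by move=> H [|//] y _ Uy; apply: differentiableV; [exact: (H [::])|exact: f0].
move=> Hf; have := Hf => /diff_uptoS[df Df]; have IH' := IH (diff_upto_le Hf).
apply/diff_uptoS; split=> [y Uy|v]; first by apply: differentiableV; auto.
apply: (diff_upto_eq (g := fun y =>
   ((-1 : R^o) *: ((f y)^-1 : R^o)) *: (((f y)^-1 : R^o) *: 'D_v f y))) => //.
  move=> y Uy; rewrite deriveV; [|exact: f0|exact/diff_derivable/df].
  by rewrite /GRing.scale /= expr2 invfM mulN1r !mulNr mulrA.
have c1 : diff_upto k U (fun _ : V => -1 : R^o) by exact: diff_upto_cst.
apply: diff_uptoZ => //; apply: diff_uptoZ => //.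
Qed.

Lemma near_neq0 (T : topologicalType) (f : T -> R^o) x :
  {for x, continuous f} -> f x != 0 ->
  \forall y \near x, f y != 0.
Proof.
move=> cf f0; apply: (cf [set z : R^o | z != 0]).
exact: open_nbhs_nbhs (conj (@open_neq _ _) f0).
Qed.

Lemma smooth_atV V (f : V -> R^o) x : f x != 0 -> smooth_at f x ->
  smooth_at (fun y => (f y)^-1 : R^o) x.
Proof.
move=> fx0 sf; have cf := smooth_at_continuous sf.
have : \forall y \near x, f y != 0 /\ smooth_on [set y] f.
  by apply: filterI => //; exact: near_neq0.
move=> /near_open[U [oU Ux HU]]; apply/smooth_at_open; exists U; split=> //.
apply/smooth_on_upto => k; apply: diff_uptoV => //.
  by move=> y /HU[].
by move=> vs y _ /HU[_]; exact.
Qed.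

Lemma smooth_at_det V n (f : V -> 'M[R]_n) x :
  (forall i j, smooth_at (fun y => f y i j : R^o) x) ->
  smooth_at (fun y => \det (f y) : R^o) x.
Proof.
move=> sf; rewrite /determinant; apply: smooth_at_sum => s _.
apply: smooth_atM; first exact: smooth_at_cst.
by apply: smooth_at_prod => i _; exact: sf.
Qed.

(** Cramer's rule: the entries of the inverse are polynomials in the entries of
[f y], divided by the determinant. *)
Lemma smooth_at_invmx V n (f : V -> 'M[R]_n) x : f x \in unitmx ->
  (forall i j, smooth_at (fun y => f y i j : R^o) x) ->
  forall i j, smooth_at (fun y => invmx (f y) i j : R^o) x.
Proof.
move=> fu sf i j; have sd := smooth_at_det sf.
have d0 : \det (f x) != 0 by rewrite -unitfE -unitmxE.
have : smooth_at (fun y => (\det (f y))^-1 *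
    ((-1) ^+ (j + i) * \det (row' j (col' i (f y)))) : R^o) x.
  apply: smooth_atM; first exact: smooth_atV.
  apply: smooth_atM; first exact: smooth_at_cst.
  apply: smooth_at_det => a b; apply: smooth_at_ext (sf (lift j a) (lift i b)) => y.
  by rewrite !mxE.
apply: smooth_at_eq.
have : \forall y \near x, \det (f y) != 0.
  by apply: near_neq0 => //; exact: smooth_at_continuous sd.
apply: filterS => y dy.
by rewrite /invmx unitmxE unitfE dy !mxE.
Qed.

End Targets.

(** * A flat function *)

Section Flat.
Context {R : realType}.
Implicit Types (p : {poly R}) (t : R).

(** The family P(1/t) exp(-1/t), extended by 0 to t <= 0. It is closed under
differentiation, so that its members are smooth as soon as they are
differentiable; P = 1 gives the bump functions. *)
Definition flat p t : R := if 0 < t then p.[t^-1] * expR (- t^-1) else 0.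

Lemma poly_bound p u : 1 <= u ->
  `|p.[u]| <= (\sum_(i < size p) `|p`_i|) * u ^+ size p.
Proof.
move=> u1; rewrite horner_coef mulr_suml; apply: le_trans (ler_norm_sum _ _ _) _.
apply: ler_sum => i _; rewrite normrM; apply: ler_wpM2l => //.
by rewrite ger0_norm ?exprn_ge0 ?(le_trans ler01) // ler_weXn2l // ltnW.
Qed.

(** Since exp(u) dominates every power of u, the members of the family are O(t^2)
at 0, and their derivative there is 0. *)
Lemma flat_bound p : exists2 C, 0 <= C &
  forall t, t < 1 -> `|flat p t| <= C * t ^+ 2.
Proof.
pose C := \sum_(i < size p) `|p`_i|; pose d := size p.
(* |P(u)| <= C u^d for u >= 1, and exp(u) >= u^(d+2) / (d+2)! at u = 1/t. *)
have C0 : 0 <= C by apply: sumr_ge0.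
exists (C * (d.+2)`!%:R) => [|t t1]; first by rewrite mulr_ge0.
rewrite /flat; case: ltP => t0; last first.
  by rewrite normr0; apply: mulr_ge0; [exact: mulr_ge0|exact: sqr_ge0].
have u1 : 1 <= t^-1 by rewrite invf_ge1 // ltW.
have u0 : 0 < t^-1 by rewrite invr_gt0.
have e0 : t^-1 ^+ d.+2 / (d.+2)`!%:R <= expR t^-1.
  by apply: le_trans (expR_ge1Dxn d.+1 (ltW u0)); rewrite lerDr.
rewrite normrM [`|expR _|]ger0_norm ?expR_ge0 // expRN.
apply: (@le_trans _ _ (C * t^-1 ^+ d * (expR t^-1)^-1)).
  by apply: ler_wpM2r; [rewrite invr_ge0 expR_ge0|exact: poly_bound].
rewrite -!mulrA; apply: ler_wpM2l => //.
have f0 : 0 < ((d.+2)`!%:R : R) by rewrite ltr0n fact_gt0.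
rewrite ler_pdivrMr ?expR_gt0 //.
apply: le_trans (ler_wpM2l _ e0); last by rewrite mulr_ge0 ?sqr_ge0 // ltW.
rewrite -addn2 exprD.
have -> : (d + 2)`!%:R * t ^+ 2 * (t^-1 ^+ d * t^-1 ^+ 2 / (d + 2)`!%:R) =
  t^-1 ^+ d * ((d + 2)`!%:R / (d + 2)`!%:R) * (t * t^-1) ^+ 2 :> R by ring.
by rewrite !divff ?gt_eqF // ?addn2 // !mulr1 expr1n mulr1.
Qed.

Lemma flat_derive p t :
  is_derive t 1 (flat p : R^o -> R^o) (flat ('X^2 * (p - p^`())) t).
Proof.
have [t0|t0|t0] := ltgtP t 0.
- rewrite [flat _ t]/flat ltNge (ltW t0) /=.
  have : is_derive t 1 (cst 0 : R^o -> R^o) (0 : R^o) by exact: is_derive_cst.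
  apply: near_eq_is_derive => //.
  near=> s; rewrite /flat ltNge /= ifF //.
  by apply/negbTE; rewrite negbK ltW //; near: s; exact: lt_nbhsl.
- have tn0 : t != 0 by rewrite gt_eqF.
  have di : is_derive t 1 (fun s : R => s^-1) (- t ^- 2).
    apply: DeriveDef; first by apply: derivableV => //; exact: derivable_id.
    by rewrite deriveV // derive_id /GRing.scale /= mulr1.
  have dG : is_derive t^-1 1 (fun u : R => p.[u] * expR (- u))
      ((p^`() - p).[t^-1] * expR (- t^-1)).
    have dN : is_derive (t^-1 : R) 1 (-%R : R -> R) (-1) by exact: is_deriveNid.
    have de := is_derive1_comp (is_derive_expR (- t^-1)) dN.
    apply: is_derive_eq (is_deriveM (is_derive_poly p t^-1) de) _.
    by rewrite hornerD hornerN /GRing.scale /=; ring.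
  have := is_derive1_comp dG di.
  have -> : (p^`() - p).[t^-1] * expR (- t^-1) * (- t ^- 2) =
      flat ('X^2 * (p - p^`())) t.
    by rewrite /flat t0 hornerM hornerXn !hornerD !hornerN exprVn; ring.
  apply: near_eq_is_derive; near=> s; rewrite /flat ifT //.
  by near: s; exact: lt_nbhsr.
rewrite t0 [flat _ 0]/flat ltxx.
have [C C0 HC] := flat_bound p.
have cv : (fun h : R => h^-1 *: ((flat p \o shift 0) (h *: 1) - flat p 0 : R^o))
    @ 0^' --> (0 : R^o).
  have CC : 0 < C + 1 by rewrite ltr_wpDl.
  apply/cvgr0Pnorm_lt => e e0; near=> h.
  have h0 : h != 0 by near: h; exact: nbhs_dnbhs_neq.
  have hn : 0 < `|h| by rewrite normr_gt0.
  have he : `|h| < e / (C + 1) by near: h; apply: dnbhs0_lt; rewrite divr_gt0.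
  have h1 : `|h| < 1 by near: h; exact: dnbhs0_lt.
  rewrite /= {2}/flat ltxx subr0 addr0 [h *: 1]mulr1 normrM normfV.
  rewrite mulrC ltr_pdivrMr //.
  apply: le_lt_trans (HC h (le_lt_trans (ler_norm h) h1)) _.
  rewrite -real_normK ?num_real // expr2 mulrA ltr_pM2r //.
  apply: (@le_lt_trans _ _ ((C + 1) * `|h|)); last by rewrite mulrC -ltr_pdivlMr.
  by rewrite ler_pM2r // lerDl.
by apply: DeriveDef; [apply/cvg_ex; exists 0|exact: cvg_lim cv].
Unshelve. all: by end_near. Qed.

Lemma smooth_flat p x : smooth_at (flat p : R^o -> R^o) x.
Proof.
have H k q : diff_upto k setT (flat q : R^o -> R^o).
  elim: k q => [|k IH] q.
    case=> [|//] y _ _; apply/derivable1_diffP; have d := flat_derive q y.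
    exact: ex_derive.
  have d y : differentiable (flat q : R^o -> R^o) y.
    by apply/derivable1_diffP; have d := flat_derive q y; exact: ex_derive.
  apply/diff_uptoS; split=> [y _|v]; first exact: d.
  have -> : 'D_v (flat q : R^o -> R^o) =
      (fun y => v *: (flat ('X^2 * (q - q^`())) y : R^o)).
    apply/funext => y; rewrite deriveE // -[v in LHS]mulr1.
    rewrite -[v * 1]/(v *: (1 : R^o)) linearZ /= -deriveE //.
    by have d' := flat_derive q y; rewrite derive_val.
  apply: (@diff_uptoZ _ _ _ _ _ (fun _ => v)); first exact: openT.
    exact: diff_upto_cst.
  exact: IH.
by apply/smooth_at_open; exists setT; split=> //; [exact: openT|exact/smooth_on_upto].
Qed.

Lemma flat1_gt0 t : 0 < t -> 0 < flat 1 t.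
Proof. by move=> t0; rewrite /flat t0 hornerC mul1r expR_gt0. Qed.

Lemma flat_le0 p t : t <= 0 -> flat p t = 0.
Proof. by rewrite /flat ltNge => ->. Qed.

End Flat.

(** * Germs and differentials on manifolds *)

Section Germs.
Context {R : realType}.

Lemma near_diff_eq (V W : normedModType R) (f g : V -> W) x v :
  (\forall y \near x, f y = g y) -> differentiable g x -> 'd f x v = 'd g x v.
Proof.
move=> fg dg; have df := diff_near fg dg.
by rewrite -!deriveE //; exact: near_eq_derive.
Qed.

Lemma near_comp (T S : topologicalType) (f : T -> S) x (P : S -> Prop) :
  {for x, continuous f} -> (\forall y \near f x, P y) ->
  \forall y \near x, P (f y).
Proof. by move=> cf nP; exact: (cf P nP). Qed.

End Germs.

Section Manifold.
Context {R : realType} {n : nat} {M : manifold R n}.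
Implicit Types (c d : chart M 'rV[R]_n) (p : M) (V W Z : normedModType R).

Lemma chart_at_atlas p : atlas M (chart_at p).
Proof. by rewrite /chart_at; case: cid2. Qed.

Lemma near_cdom V (c : chart M V) p : cdom c p -> \forall q \near p, cdom c q.
Proof. by move=> cp; apply: open_nbhs_nbhs; split=> //; exact: cdom_open. Qed.

Lemma near_cinvK V (c : chart M V) p : cdom c p ->
  \forall v \near c p, cdom c (cinv c v) /\ c (cinv c v) = v.
Proof.
move=> cp; have nI : nbhs (c p) (c @` cdom c).
  by apply: open_nbhs_nbhs; split; [exact: cimg_open|exists p].
by apply: filterS nI => _ [q cq <-]; rewrite cmapK.
Qed.

Lemma near_cinv V (c : chart M V) p (P : M -> Prop) : cdom c p ->
  (\forall q \near p, P q) -> \forall v \near c p, P (cinv c v).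
Proof.
by move=> cp nP; apply: near_comp; [exact: cinv_cont|rewrite cmapK].
Qed.

Lemma smooth_at_transition c d p : atlas M c -> atlas M d -> cdom c p ->
  cdom d p -> smooth_at (d \o cinv c) (c p).
Proof.
move=> ac ad cp dp; have := atlas_compat ac ad.
move/smooth_on_at; apply; last by exists p.
by apply: chart_img_open; exact: cdom_open.
Qed.

Definition msmooth_at W (f : M -> W) p : Prop :=
  smooth_at (f \o cinv (chart_at p)) (chart_at p p).

(** Smoothness does not depend on the chart, by the chain rule applied to the
transition map. *)
Lemma smooth_at_chart W (f : M -> W) c d p : atlas M c -> atlas M d ->
  cdom c p -> cdom d p ->
  smooth_at (f \o cinv d) (d p) -> smooth_at (f \o cinv c) (c p).
Proof.
move=> ac ad cp dp sf.
have : smooth_at ((f \o cinv d) \o (d \o cinv c)) (c p).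
  apply: smooth_at_comp; first exact: findim_mx.
    exact: smooth_at_transition.
  by rewrite /= cmapK.
apply: smooth_at_eq; have := near_cinv cp (near_cdom dp).
by apply: filterS => v dv /=; rewrite cmapK.
Qed.

Lemma msmooth_atE W (f : M -> W) c p : atlas M c -> cdom c p ->
  msmooth_at f p <-> smooth_at (f \o cinv c) (c p).
Proof.
move=> ac cp; have [dp ad] := (chart_at_dom p, chart_at_atlas p).
by split; apply: smooth_at_chart.
Qed.

Lemma msmooth_at_near W (f : M -> W) p :
  msmooth_at f p -> \forall q \near p, msmooth_at f q.
Proof.
move=> /smooth_at_near/(near_comp (cmap_cont (chart_at_dom p))).
apply: filterS2 (near_cdom (chart_at_dom p)) => q pq.
by move/(msmooth_atE _ (chart_at_atlas p) pq).
Qed.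

Lemma msmooth_at_eq W (f g : M -> W) p :
  (\forall q \near p, f q = g q) -> msmooth_at g p -> msmooth_at f p.
Proof. by move/(near_cinv (chart_at_dom p)); exact: smooth_at_eq. Qed.

Lemma msmooth_at_ext W (f g : M -> W) p :
  f =1 g -> msmooth_at g p -> msmooth_at f p.
Proof. by move=> fg; apply: msmooth_at_eq; exact: nearW. Qed.

Lemma smooth_funE W (U : set M) (f : M -> W) : open U ->
  smooth_fun (atlas M) U f <-> forall p, U p -> msmooth_at f p.
Proof.
move=> oU; split=> [sf p Up|sf c ac].
  have := sf _ (chart_at_atlas p); move/smooth_on_at; apply.
    exact: chart_img_open.
  by exists p => //; split=> //; exact: chart_at_dom.
apply/smooth_on_at; first exact: chart_img_open.
by move=> _ [p [cp Up] <-]; apply/msmooth_atE => //; exact: sf.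
Qed.

Lemma msmooth_smooth_fun W (S : set M) (f : M -> W) :
  (forall p, S p -> msmooth_at f p) -> smooth_fun (atlas M) S f.
Proof.
move=> sf c ac vs _ [p [cp Sp] <-].
by have /nbhs_singleton := (msmooth_atE f ac cp).1 (sf p Sp); exact.
Qed.

Lemma smooth_fun_near W (S : set M) (f : M -> W) p :
  smooth_fun (atlas M) S f -> (\forall q \near p, S q) -> msmooth_at f p.
Proof.
move=> sf /near_open[U [oU Up US]].
have /smooth_funE : smooth_fun (atlas M) U f.
  move=> c ac vs _ [q [cq Uq] <-]; apply: (sf c ac).
  by exists q => //; split=> //; exact: US.
by apply.
Qed.

Lemma msmooth_at_continuous W (f : M -> W) p :
  msmooth_at f p -> {for p, continuous f}.
Proof.
move=> /smooth_at_continuous cf.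
have cp := chart_at_dom p.
have h : {for p, continuous (f \o cinv (chart_at p) \o chart_at p)}.
  apply: continuous_comp; first exact: cmap_cont.
  exact: cf.
have e : \forall q \near p, (f \o cinv (chart_at p) \o chart_at p) q = f q.
  by apply: filterS (near_cdom cp) => q pq /=; rewrite cmapK.
move=> A nA; have {}h := h A; rewrite /= cmapK // in h.
by apply: filterS2 e (h nA) => q /= ->.
Qed.

Lemma msmooth_at_comp V W (f : M -> V) (g : V -> W) p : findim V ->
  msmooth_at f p -> smooth_at g (f p) -> msmooth_at (g \o f) p.
Proof.
move=> fV sf sg; apply: (smooth_at_comp (f := f \o cinv (chart_at p))) => //.
by rewrite /= cmapK //; exact: chart_at_dom.
Qed.

(** Computed, as [tcoord] and [tangent_map] are, in the chart chosen at p, so that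
[mdiff c] is [tcoord c] for every chart c. *)
Definition mdiff W (f : M -> W) p (v : tangent p) : W :=
  'd (f \o cinv (chart_at p)) (chart_at p p) v.

Lemma mdiffP W (f : M -> W) p a (v w : tangent p) :
  mdiff f (a *: v + w) = a *: mdiff f v + mdiff f w.
Proof. exact: linearP. Qed.

Lemma mdiff0 W (f : M -> W) p : mdiff f (0 : tangent p) = 0.
Proof. exact: linear0. Qed.

Lemma mdiffZ W (f : M -> W) p a (v : tangent p) :
  mdiff f (a *: v) = a *: mdiff f v.
Proof. exact: linearZ. Qed.

Lemma mdiff_sum W (f : M -> W) p I (r : seq I) (v : I -> tangent p) :
  mdiff f (\sum_(i <- r) v i) = \sum_(i <- r) mdiff f (v i).
Proof. exact: linear_sum. Qed.

Lemma mdiff_eq W (f g : M -> W) p (v : tangent p) :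
  (\forall q \near p, f q = g q) -> msmooth_at g p -> mdiff f v = mdiff g v.
Proof.
move=> /(near_cinv (chart_at_dom p)) fg /smooth_at_diff dg.
exact: near_diff_eq.
Qed.

Lemma mdiff_comp V W (f : M -> V) (g : V -> W) p (v : tangent p) :
  msmooth_at f p -> differentiable g (f p) ->
  mdiff (g \o f) v = 'd g (f p) (mdiff f v).
Proof.
move=> /smooth_at_diff df dg; have e : cinv (chart_at p) (chart_at p p) = p.
  by rewrite cmapK //; exact: chart_at_dom.
have := @diff_comp _ _ _ _ (f \o cinv (chart_at p)) g (chart_at p p) df.
rewrite /= e => /(_ dg) /(congr1 (fun h => h v)).
exact.
Qed.

(** Unlike the charts of the atlas, such coordinates may take values in any normed
space, as the adapted coordinates of a bundle do. *)
Definition local_coords V (a : M -> V) (ai : V -> M) p : Prop :=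
  [/\ msmooth_at a p,
      (\forall q \near p, ai (a q) = q),
      (\forall v \near a p, a (ai v) = v),
      {for a p, continuous ai} &
      smooth_at (chart_at p \o ai) (a p)].

(** [coords_vec c (cinv c) p] is [tvec c p]; the general form serves coordinates
that are not charts of the atlas. *)
Definition coords_vec V (a : M -> V) (ai : V -> M) p (w : V) : tangent p :=
  'd (chart_at p \o ai) (a p) w.

Section Coords.
Context {V : normedModType R} (a : M -> V) (ai : V -> M) (p : M).
Hypotheses (fV : findim V) (Ha : local_coords a ai p).

Lemma coords_smooth W (f : M -> W) :
  msmooth_at f p <-> smooth_at (f \o ai) (a p).
Proof.
case: Ha => sa aK aiK cai sai; have e := nbhs_singleton aK.
split=> sf; last first.
  have := msmooth_at_comp fV sa sf; apply: msmooth_at_eq.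
  by apply: filterS aK => q /= ->.
have : smooth_at ((f \o cinv (chart_at p)) \o (chart_at p \o ai)) (a p).
  apply: smooth_at_comp => //; first exact: findim_mx.
  by rewrite /= e.
apply: smooth_at_eq.
have : \forall v \near a p, cdom (chart_at p) (ai v).
  by apply: near_comp => //; rewrite e; apply: near_cdom; exact: chart_at_dom.
by apply: filterS => v dv /=; rewrite cmapK.
Qed.

Lemma mdiff_coords W (f : M -> W) (v : tangent p) : msmooth_at f p ->
  mdiff f v = 'd (f \o ai) (a p) (mdiff a v).
Proof.
move=> sf; have sfa := (coords_smooth f).1 sf; case: Ha => sa aK aiK cai sai.
rewrite -mdiff_comp //; last exact: smooth_at_diff.
apply: mdiff_eq; last exact: msmooth_at_comp.
by apply: filterS aK => q /= ->.
Qed.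

Lemma mdiff_coords_vec W (f : M -> W) (w : V) : msmooth_at f p ->
  mdiff f (coords_vec a ai p w) = 'd (f \o ai) (a p) w.
Proof.
move=> sf; case: Ha => sa aK aiK cai sai; have e := nbhs_singleton aK.
have dp := chart_at_dom p.
have := sf => /smooth_at_diff df.
have := @diff_comp _ _ _ _ (chart_at p \o ai) (f \o cinv (chart_at p)) (a p)
  (smooth_at_diff sai).
rewrite /= e => /(_ df) /(congr1 (fun h => h w)) H.
apply: (etrans (esym H)); apply: near_diff_eq; last first.
  by apply: smooth_at_diff; apply/coords_smooth.
have : \forall v \near a p, cdom (chart_at p) (ai v).
  by apply: near_comp => //; rewrite e; apply: near_cdom.
by apply: filterS => v dv /=; rewrite cmapK.
Qed.

Lemma coords_vecK (w : V) : mdiff a (coords_vec a ai p w) = w.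
Proof.
case: Ha => sa aK aiK cai sai; rewrite mdiff_coords_vec //.
transitivity ('d (id : V -> V) (a p) w); last by rewrite diff_val.
apply: near_diff_eq; first exact: aiK.
by apply: ex_diff; exact: is_diff_id.
Qed.

End Coords.

Lemma local_coords_chart c p : atlas M c -> cdom c p ->
  local_coords c (cinv c) p.
Proof.
move=> ac cp; split.
- apply: smooth_at_transition => //; [exact: chart_at_atlas|exact: chart_at_dom].
- by apply: filterS (near_cdom cp) => q; exact: cmapK.
- by apply: filterS (near_cinvK cp) => v [].
- exact: cinv_cont.
- by apply: smooth_at_transition => //; [exact: chart_at_atlas|exact: chart_at_dom].
Qed.

Lemma mdiff_chart_at p (v : tangent p) : mdiff (chart_at p) v = v.
Proof.
have dp := chart_at_dom p.
transitivity ('d (id : 'rV[R]_n -> 'rV[R]_n) (chart_at p p) v); last first.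
  by rewrite diff_val.
apply: near_diff_eq; last by apply: ex_diff; exact: is_diff_id.
by apply: filterS (near_cinvK dp) => w [].
Qed.

Lemma mdiffK V (a : M -> V) (ai : V -> M) p (v : tangent p) : findim V ->
  local_coords a ai p -> coords_vec a ai p (mdiff a v) = v.
Proof.
move=> fV Ha; rewrite -[RHS]mdiff_chart_at.
rewrite [RHS](mdiff_coords fV Ha) //.
by have [] := local_coords_chart (chart_at_atlas p) (chart_at_dom p).
Qed.

End Manifold.

(** * Vector fields, bump functions and smooth maps *)

Section Functions.
Context {R : realType} {n : nat} {M : manifold R n}.
Implicit Types (c d : chart M 'rV[R]_n) (p : M) (V W Z : normedModType R).

Lemma msmooth_at_cst W (w : W) p : msmooth_at (fun _ : M => w) p.
Proof. exact: smooth_at_cst. Qed.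

Lemma msmooth_atZ W (f : M -> R^o) (g : M -> W) p :
  msmooth_at f p -> msmooth_at g p -> msmooth_at (fun q => f q *: g q) p.
Proof. exact: smooth_atZ. Qed.

Lemma msmooth_atD W (f g : M -> W) p :
  msmooth_at f p -> msmooth_at g p -> msmooth_at (fun q => f q + g q) p.
Proof. exact: smooth_atD. Qed.

Lemma msmooth_at_sum W (I : Type) (r : seq I) (f : I -> M -> W) p :
  (forall i, msmooth_at (f i) p) ->
  msmooth_at (fun q => \sum_(i <- r) f i q) p.
Proof. by move=> sf; apply: smooth_at_sum => i _; exact: sf. Qed.

Lemma msmooth_at_pair W Z (f : M -> W) (g : M -> Z) p :
  msmooth_at f p -> msmooth_at g p -> msmooth_at (fun q => (f q, g q)) p.
Proof. exact: smooth_at_pair. Qed.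

Lemma msmooth_at_snd W Z (f : M -> W * Z) p :
  msmooth_at f p -> msmooth_at (fun q => (f q).2) p.
Proof. exact: smooth_at_snd. Qed.

Lemma msmooth_at_entry a b (f : M -> 'M[R]_(a, b)) i j p :
  msmooth_at f p -> msmooth_at (fun q => f q i j : R^o) p.
Proof. exact: smooth_at_entry. Qed.

Lemma msmooth_at_mx a b (f : M -> 'M[R]_(a, b)) p :
  (forall i j, msmooth_at (fun q => f q i j : R^o) p) -> msmooth_at f p.
Proof. exact: smooth_at_mx. Qed.

Lemma msmooth_at_mulmx a b e (f : M -> 'M[R]_(a, b)) (g : M -> 'M[R]_(b, e)) p :
  msmooth_at f p -> msmooth_at g p -> msmooth_at (fun q => f q *m g q) p.
Proof. exact: smooth_at_mulmx. Qed.

Lemma msmooth_atV (f : M -> R^o) p : f p != 0 -> msmooth_at f p ->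
  msmooth_at (fun q => (f q)^-1 : R^o) p.
Proof.
move=> f0; apply: smooth_atV; rewrite /= cmapK //; exact: chart_at_dom.
Qed.

Lemma msmooth_at_invmx a (f : M -> 'M[R]_a) p : f p \in unitmx ->
  msmooth_at f p -> msmooth_at (fun q => invmx (f q)) p.
Proof.
move=> f0 sf; apply: smooth_at_mx; apply: smooth_at_invmx.
  by rewrite /= cmapK //; exact: chart_at_dom.
by move=> i j; exact: smooth_at_entry sf.
Qed.

(** The chart chosen at p is kept for all q near p. *)
Definition sec_smooth_at (X : forall p : M, tangent p) p : Prop :=
  msmooth_at (fun q => mdiff (chart_at p) (X q)) p.

(** Near p, the differential of f is that of [f \o ai], applied to the components
of X in the coordinates [a]. *)
Lemma coords_section_smooth V W (a : M -> V) (ai : V -> M)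
    (X : forall p : M, tangent p) (f : M -> W) p : findim V ->
  (\forall q \near p, local_coords a ai q) ->
  msmooth_at (fun q => mdiff a (X q)) p -> msmooth_at f p ->
  msmooth_at (fun q => mdiff f (X q)) p.
Proof.
move=> fV Ha sX sf; have Hp := nbhs_singleton Ha.
apply: (msmooth_at_eq (g := fun q => 'd (f \o ai) (a q) (mdiff a (X q)))).
  apply: filterS2 Ha (msmooth_at_near sf) => q Hq sq.
  exact: (mdiff_coords fV Hq _ sq).
apply: (smooth_at_diff_app (g := f \o ai) (c := a \o cinv (chart_at p))) => //.
  rewrite /= cmapK; last exact: chart_at_dom.
  exact/coords_smooth.
by case: Hp.
Qed.

Lemma near_chart_coords c p : atlas M c -> cdom c p ->
  \forall q \near p, local_coords c (cinv c) q.
Proof.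
by move=> ac cp; apply: filterS (near_cdom cp) => q; exact: local_coords_chart.
Qed.

Lemma msmooth_at_chart c p : atlas M c -> cdom c p -> msmooth_at c p.
Proof. by move=> ac cp; case: (local_coords_chart ac cp). Qed.

Lemma sec_smooth_mdiff W (X : forall p : M, tangent p) (f : M -> W) p :
  sec_smooth_at X p -> msmooth_at f p ->
  msmooth_at (fun q => mdiff f (X q)) p.
Proof.
apply: (@coords_section_smooth _ _ _ (cinv (chart_at p))).
  exact: findim_mx.
by apply: near_chart_coords; [exact: chart_at_atlas|exact: chart_at_dom].
Qed.

Lemma sec_smooth_coords V (a : M -> V) (ai : V -> M)
    (X : forall p : M, tangent p) p : findim V ->
  (\forall q \near p, local_coords a ai q) ->
  msmooth_at (fun q => mdiff a (X q)) p -> sec_smooth_at X p.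
Proof.
move=> fV Ha sX; apply: coords_section_smooth Ha _ _ => //.
by apply: msmooth_at_chart; [exact: chart_at_atlas|exact: chart_at_dom].
Qed.

Lemma smooth_sectionE (U : set M) (X : forall p : M, tangent p) : open U ->
  smooth_section U X <-> forall p, U p -> sec_smooth_at X p.
Proof.
move=> oU; split=> [sX p Up|sX c ac].
  have /smooth_funE := sX _ (chart_at_atlas p).
  move=> /(_ (openI oU (@cdom_open _ _ _ _)))/(_ p); apply.
  by split=> //; exact: chart_at_dom.
apply: msmooth_smooth_fun => p [Up cp].
by apply: sec_smooth_mdiff; [exact: sX|exact: msmooth_at_chart].
Qed.

Lemma sec_smooth_eq (X Y : forall p : M, tangent p) p :
  (\forall q \near p, X q = Y q) -> sec_smooth_at Y p -> sec_smooth_at X p.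
Proof. by move=> XY; apply: msmooth_at_eq; apply: filterS XY => q ->. Qed.

Lemma sec_smoothZ (f : M -> R^o) (X : forall p : M, tangent p) p :
  msmooth_at f p -> sec_smooth_at X p ->
  sec_smooth_at (fun q => f q *: X q) p.
Proof.
move=> sf sX; by apply: msmooth_at_ext (msmooth_atZ sf sX) => q; rewrite mdiffZ.
Qed.

Lemma sec_smooth_sum (I : Type) (r : seq I) (X : I -> forall p : M, tangent p) p :
  (forall i, sec_smooth_at (X i) p) ->
  sec_smooth_at (fun q => \sum_(i <- r) X i q) p.
Proof.
move=> sX; by apply: msmooth_at_ext (msmooth_at_sum r sX) => q; rewrite mdiff_sum.
Qed.

Lemma sec_smooth_coords_vec V (a : M -> V) (ai : V -> M) (w : M -> V) p :
  findim V -> (\forall q \near p, local_coords a ai q) -> msmooth_at w p ->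
  sec_smooth_at (fun q => coords_vec a ai q (w q)) p.
Proof.
move=> fV Ha sw; apply: (sec_smooth_coords fV Ha).
apply: msmooth_at_eq sw; apply: filterS Ha => q Hq.
exact: coords_vecK.
Qed.

(** In a chart take exp(-1/s) with s = r^2 - |x - c p|^2. Its support comes from a
compact set of the model space; the image of this set in M is compact, hence
closed because M is Hausdorff, and so the extension by 0 is smooth at the
points outside the chart. *)
Lemma exists_bump p (U : set M) : open U -> U p -> exists b : M -> R^o,
  [/\ forall q, msmooth_at b q, b p = 1 &
      forall q, ~ U q -> \forall r \near q, b r = 0].
Proof.
move=> oU Up; pose c := chart_at p; have cp : cdom c p by exact: chart_at_dom.
have ac : atlas M c by exact: chart_at_atlas.
have : nbhs (c p) (c @` (cdom c `&` U)).
  by apply: open_nbhs_nbhs; split; [exact: chart_img_open|exists p].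
move=> /nbhs_ballP[e /= e0 be]; pose r := e / 2.
have r0 : 0 < r by rewrite divr_gt0.
pose s (x : 'rV[R]_n) : R^o := r ^+ 2 - \sum_i (x 0 i - c p 0 i) ^+ 2.
have ss x : smooth_at s x.
  apply: (smooth_at_ext (g := fun y : 'rV[R]_n => (r ^+ 2 : R^o) +
      (-1 : R^o) *: \sum_i ((y 0 i : R^o) + (- c p 0 i : R^o)) *:
        ((y 0 i : R^o) + (- c p 0 i : R^o)))).
    by move=> y; rewrite /s scaleN1r; congr (_ - _); apply: eq_bigr => i _.
  have sy i : smooth_at (fun y : 'rV[R]_n => (y 0 i : R^o) + (- c p 0 i : R^o)) x.
    apply: smooth_atD; last exact: smooth_at_cst.
    exact: (smooth_at_entry (f := id) _ _ (smooth_at_id x)).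
  apply: smooth_atD; first exact: smooth_at_cst.
  apply: smooth_atZ; first exact: smooth_at_cst.
  by apply: smooth_at_sum => i _; exact: smooth_atZ.
pose A := [set x | 0 <= s x].
have Ab : A `<=` ball (c p) e.
  move=> x; rewrite /A /s /= subr_ge0 => sx; split=> // i j.
  rewrite ord1 /ball /= distrC; apply: (@le_lt_trans _ _ r); last first.
    by rewrite /r ltr_pdivrMr // ltr_pMr // ltr1n.
  rewrite -(ler_pXn2r (n := 2)) ?nnegrE //; last exact: ltW.
  rewrite real_normK ?num_real //; apply: le_trans sx.
  by rewrite (bigD1 j) //= lerDl; apply: sumr_ge0 => k _; exact: sqr_ge0.
have Ac : compact A.
  apply: bounded_closed_compact.
    exists (`|c p| + e); split=> [|y ye x /Ab]; first exact: num_real.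
    rewrite -ball_normE /= => h; apply: le_trans (ltW ye).
    rewrite -[x](subrK (c p)) addrC; apply: le_trans (ler_normD _ _) _.
    by rewrite lerD2l distrC ltW.
  apply: (@preimage_closed _ _ s [set y : R^o | 0 <= y]); last exact: closed_ge.
  by move=> x _; exact: (smooth_at_continuous (ss x)).
(* K contains the points where b does not vanish. *)
pose K := cinv c @` A.
have AcI x : A x -> exists2 q, (cdom c `&` U) q & c q = x by move=> /Ab/be.
have Kcl : closed K.
  apply: compact_closed; first exact: manifold_hausdorff.
  apply: continuous_compact => //; apply: continuous_in_subspaceT => x.
  by rewrite inE => /AcI[q [cq _] <-]; exact: cinv_cont.
have KU : K `<=` U by move=> _ [x /AcI[q [cq Uq] <-] <-]; rewrite cmapK.
pose b (q : M) : R^o :=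
  if `[< cdom c q >] then (flat 1 (s (c p)))^-1 * flat 1 (s (c q)) else 0.
have bK q : ~ K q -> b q = 0.
  move=> Kq; rewrite /b; case: asboolP => // cq.
  rewrite [flat 1 (s (c q))]flat_le0 ?mulr0 // leNgt; apply/negP => sq.
  by apply: Kq; exists (c q); [exact: ltW|rewrite cmapK].
have nK q : ~ K q -> \forall r \near q, b r = 0.
  move=> Kq; have : nbhs q (~` K).
    by apply: open_nbhs_nbhs; split=> //; exact: closed_openC.
  by apply: filterS => x /bK.
exists b; split=> [q||q Uq]; last by apply: nK => /KU.
- have [cq|cq] := pselect (cdom c q); last first.
    apply: msmooth_at_eq (msmooth_at_cst 0 q); apply: nK => -[x /AcI[q' [cq' _] <-]].
    by rewrite cmapK // => e'; apply: cq; rewrite -e'.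
  apply: (msmooth_at_eq (g := fun q : M =>
      (flat 1 (s (c p)))^-1 *: (flat 1 (s (c q)) : R^o))).
    by apply: filterS (near_cdom cq) => q' cq'; rewrite /b asboolT.
  apply: msmooth_atZ; first exact: msmooth_at_cst.
  apply: (msmooth_at_comp (f := c) (g := fun x => flat 1 (s x) : R^o)).
  - exact: findim_mx.
  - exact: msmooth_at_chart.
  - by apply: smooth_at_comp; [exact: findim_scalar|exact: ss|exact: smooth_flat].
- rewrite /b asboolT // mulVf // gt_eqF //; apply: flat1_gt0.
  rewrite /s big1 ?subr0 ?exprn_gt0 // => i _.
  by rewrite subrr expr0n.
Qed.

Lemma msmooth_at_bump W (U : set M) (b : M -> R^o) (f : M -> W) :
  (forall q, msmooth_at b q) -> (forall q, ~ U q -> \forall r \near q, b r = 0) ->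
  (forall q, U q -> msmooth_at f q) -> forall q, msmooth_at (fun q => b q *: f q) q.
Proof.
move=> sb bU sf q; have [Uq|/bU bq] := pselect (U q).
  by apply: msmooth_atZ => //; exact: sf.
apply: msmooth_at_eq (msmooth_at_cst 0 q).
by apply: filterS bq => r ->; rewrite scale0r.
Qed.

Lemma sec_smooth_bump (U : set M) (b : M -> R^o) (X : forall p : M, tangent p) :
  (forall q, msmooth_at b q) -> (forall q, ~ U q -> \forall r \near q, b r = 0) ->
  (forall q, U q -> sec_smooth_at X q) ->
  smooth_section setT (fun q => b q *: X q).
Proof.
move=> sb bU sX; apply/smooth_sectionE; first exact: openT.
move=> q _; have [Uq|/bU bq] := pselect (U q).
  by apply: sec_smoothZ => //; exact: sX.
apply: msmooth_at_eq (msmooth_at_cst 0 q).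
by apply: filterS bq => r ->; rewrite scale0r mdiff0.
Qed.

End Functions.

Section Maps.
Context {R : realType} {n m : nat} {M : manifold R n} {N : manifold R m}.
Implicit Types (phi : M -> N) (p : M) (W : normedModType R).

Definition smap_at phi p : Prop :=
  {for p, continuous phi} /\ msmooth_at (chart_at (phi p) \o phi) p.

Lemma smap_at_comp W phi (f : N -> W) p :
  smap_at phi p -> msmooth_at f (phi p) -> msmooth_at (f \o phi) p.
Proof.
move=> [cphi sphi] sf; have dp := chart_at_dom (phi p).
have : msmooth_at ((f \o cinv (chart_at (phi p))) \o (chart_at (phi p) \o phi)) p.
  by apply: msmooth_at_comp => //; exact: findim_mx.
apply: msmooth_at_eq; have := near_comp cphi (near_cdom dp).
by apply: filterS => q dq /=; rewrite cmapK.
Qed.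

Lemma mdiff_tangent_map W phi (f : N -> W) p (v : tangent p) :
  smap_at phi p -> msmooth_at f (phi p) ->
  mdiff f (tangent_map phi p v) = mdiff (f \o phi) v.
Proof.
move=> [cphi sphi] sf; have dp := chart_at_dom (phi p).
have e : tangent_map phi p v = mdiff (chart_at (phi p) \o phi) v.
  by rewrite /tangent_map lfunE.
have sm : msmooth_at ((f \o cinv (chart_at (phi p))) \o (chart_at (phi p) \o phi)) p.
  by apply: msmooth_at_comp => //; exact: findim_mx.
rewrite e; have := @mdiff_comp _ _ _ _ _ (chart_at (phi p) \o phi)
  (f \o cinv (chart_at (phi p))) p v sphi (smooth_at_diff sf) => /= H.
rewrite {1}/mdiff -[LHS]H; apply: esym; apply: mdiff_eq => //.
have := near_comp cphi (near_cdom dp).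
by apply: filterS => q dq /=; rewrite cmapK.
Qed.

Lemma smooth_map_smap (U : set M) phi : open U ->
  smooth_map (atlas M) (atlas N) U phi <-> forall p, U p -> smap_at phi p.
Proof.
move=> oU; split=> [[cphi sphi] p Up|sphi].
  split; first exact: cphi.
  have := sphi _ (chart_at_atlas (phi p)) => /smooth_fun_near; apply.
  apply: filterI; first exact: open_nbhs_nbhs.
  apply: near_comp; first exact: cphi.
  by apply: near_cdom; exact: chart_at_dom.
split=> [p Up|d ad]; first by case: (sphi p Up).
apply: msmooth_smooth_fun => p [Up dp].
by apply: smap_at_comp; [exact: sphi|exact: msmooth_at_chart].
Qed.

End Maps.

(** * Adapted coordinates on a fibre bundle *)

Lemma smooth_on_near (R : realType) (V W : normedModType R) (U : set V)
  (f : V -> W) x : smooth_on U f -> (\forall y \near x, U y) -> smooth_at f x.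
Proof. by move=> sf; apply: filterS => y Uy vs _ ->; exact: sf. Qed.

Section Components.
Context {R : realType} {n : nat} {M : manifold R n}.
Implicit Types (p : M) (V W Z : normedModType R).

Lemma mdiff_linear V W (L : V -> W) (f : M -> V) p (v : tangent p) :
  linear L -> continuous L -> msmooth_at f p ->
  mdiff (L \o f) v = L (mdiff f v).
Proof.
move=> lL cL sf.
rewrite mdiff_comp //; last exact/smooth_at_diff/smooth_at_lin.
pose LL : {linear V -> W} := HB.pack L (GRing.isLinear.Build _ _ _ _ L lL).
by rewrite (diff_lin (f := LL) _ cL).
Qed.

Lemma mdiff_fst V W (f : M -> V * W) p (v : tangent p) :
  msmooth_at f p -> mdiff (fun q => (f q).1) v = (mdiff f v).1.
Proof.
apply: (mdiff_linear (L := fst)) => [a x y|x] //; exact: cvg_fst.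
Qed.

Lemma mdiff_snd V W (f : M -> V * W) p (v : tangent p) :
  msmooth_at f p -> mdiff (fun q => (f q).2) v = (mdiff f v).2.
Proof.
apply: (mdiff_linear (L := snd)) => [a x y|x] //; exact: cvg_snd.
Qed.

Lemma mdiff_entry a b (f : M -> 'M[R]_(a, b)) i j p (v : tangent p) :
  msmooth_at f p -> mdiff (fun q => f q i j : R^o) v = mdiff f v i j.
Proof.
apply: (mdiff_linear (L := fun A : 'M[R]_(a, b) => A i j : R^o)) => [c x y|].
  by rewrite !mxE.
exact: coord_continuous.
Qed.

Lemma mdiff_shift W (w : W) (f : M -> W) p (v : tangent p) :
  msmooth_at f p -> mdiff (fun q => w + f q) v = mdiff f v.
Proof.
move=> /smooth_at_diff df.
have dw := differentiable_cst w (chart_at p p).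
have := diffD dw df => /(congr1 (fun h => h v)) /=.
by rewrite diff_cst /= add0r.
Qed.

Section TangentCharts.
Variables (c : chart M 'rV[R]_n) (p : M).
Hypotheses (ac : atlas M c) (cp : cdom c p).

Lemma mdiff_tvec (w : 'rV[R]_n) : mdiff c (tvec c p w) = w.
Proof. exact: (coords_vecK (findim_mx _ _) (local_coords_chart ac cp)). Qed.

Lemma tvec_mdiff (v : tangent p) : tvec c p (mdiff c v) = v.
Proof. exact: (mdiffK v (findim_mx _ _) (local_coords_chart ac cp)). Qed.

Lemma mdiff_chart_inj : injective (fun v : tangent p => mdiff c v).
Proof. exact: can_inj tvec_mdiff. Qed.

Lemma tvec_sum (w : 'rV[R]_n) :
  tvec c p w = \sum_i w 0 i *: tvec c p (delta_mx 0 i).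
Proof.
rewrite {1}[w]row_sum_delta /tvec linear_sum; apply: eq_bigr => i _.
by rewrite linearZ.
Qed.

End TangentCharts.

End Components.

Section Bundle.
Context {R : realType} {n m k : nat} {M : manifold R n} {F : manifold R m}
  {E : manifold R k}.
Variable pi : fiber_bundle M F E.
Implicit Types (y q : E) (c : chart M 'rV[R]_n) (d : chart F 'rV[R]_m).

Lemma proj_smap y : smap_at pi y.
Proof. by have /smooth_map_smap := fb_smooth pi; apply => //; exact: openT. Qed.

Lemma open_proj (U : set M) : open U -> open (pi @^-1` U).
Proof.
move=> oU; rewrite openE => y Uy; have [cpi _] := proj_smap y.
by apply: cpi; exact: open_nbhs_nbhs.
Qed.

Lemma msmooth_proj c y : atlas M c -> cdom c (pi y) -> msmooth_at (c \o pi) y.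
Proof.
by move=> ac cy; apply: smap_at_comp; [exact: proj_smap|exact: msmooth_at_chart].
Qed.

Lemma mdiff_proj c y (v : tangent y) : atlas M c -> cdom c (pi y) ->
  mdiff c (tangent_map pi y v) = mdiff (c \o pi) v.
Proof.
move=> ac cy; apply: mdiff_tangent_map; first exact: proj_smap.
exact: msmooth_at_chart.
Qed.

Lemma verticalE y (v : tangent y) :
  (v \in vertical pi y) = (tangent_map pi y v == 0).
Proof. exact: memv_ker. Qed.

Lemma verticalP c y (v : tangent y) : atlas M c -> cdom c (pi y) ->
  reflect (mdiff (c \o pi) v = 0) (v \in vertical pi y).
Proof.
move=> ac cy; rewrite verticalE -mdiff_proj //; apply: (iffP eqP) => [->|].
  exact: mdiff0.
by move=> h; apply: (mdiff_chart_inj ac cy); rewrite /= h mdiff0.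
Qed.

Section Adapted.
Variables (t : trivialization F pi) (c : chart M 'rV[R]_n)
  (d : chart F 'rV[R]_m).
Hypotheses (ac : atlas M c) (ad : atlas F d).

Definition adapted_dom : set E :=
  [set y | [/\ triv_dom t (pi y), cdom c (pi y) & cdom d (triv_fib t y)]].

Definition adapted y : 'rV[R]_n * 'rV[R]_m := (c (pi y), d (triv_fib t y)).

Definition adapted_inv (v : 'rV[R]_n * 'rV[R]_m) : E :=
  triv_inv t (cinv c v.1, cinv d v.2).

Lemma findim_adapted : findim ('rV[R]_n * 'rV[R]_m)%type.
Proof. by apply: findim_prod; exact: findim_mx. Qed.

Lemma fib_smap y : triv_dom t (pi y) -> smap_at (triv_fib t) y.
Proof.
move=> ty; have /smooth_map_smap := triv_fib_smooth t; apply => //.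
by apply: open_proj; exact: triv_open.
Qed.

Lemma open_adapted_dom : open adapted_dom.
Proof.
rewrite openE => y [ty cy dy]; have [cpi _] := proj_smap y.
have [cf _] := fib_smap ty.
have h1 : \forall q \near y, triv_dom t (pi q).
  by apply: near_comp => //; apply: open_nbhs_nbhs; split=> //; exact: triv_open.
have h2 := near_comp cpi (near_cdom cy).
have h3 := near_comp cf (near_cdom dy).
by apply: filterS3 h1 h2 h3 => q.
Qed.

Lemma near_adapted_dom y : adapted_dom y -> \forall q \near y, adapted_dom q.
Proof. by move=> dy; apply: open_nbhs_nbhs; split=> //; exact: open_adapted_dom. Qed.

Lemma msmooth_fib y : adapted_dom y -> msmooth_at (d \o triv_fib t) y.
Proof.
by case=> ty cy dy; apply: smap_at_comp; [exact: fib_smap|exact: msmooth_at_chart].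
Qed.

Lemma msmooth_adapted y : adapted_dom y -> msmooth_at adapted y.
Proof.
move=> dy; apply: msmooth_at_pair; last exact: msmooth_fib.
by case: dy => ty cy _; exact: msmooth_proj.
Qed.

Lemma adapted_invK y : adapted_dom y -> adapted_inv (adapted y) = y.
Proof.
by case=> ty cy dy; rewrite /adapted_inv /adapted /= !cmapK // triv_invK.
Qed.

Lemma adaptedK (v : 'rV[R]_n * 'rV[R]_m) :
  triv_dom t (cinv c v.1) -> cdom c (cinv c v.1) -> c (cinv c v.1) = v.1 ->
  cdom d (cinv d v.2) -> d (cinv d v.2) = v.2 ->
  [/\ adapted_dom (adapted_inv v), pi (adapted_inv v) = cinv c v.1 &
      adapted (adapted_inv v) = v].
Proof.
move=> t1 c1 e1 d2 e2; have p1 := triv_proj (cinv d v.2) t1.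
have f1 := triv_fibK (cinv d v.2) t1.
split=> //; first by split; rewrite /adapted_inv ?p1 ?f1.
by rewrite /adapted /adapted_inv p1 f1 e1 e2 -surjective_pairing.
Qed.

Lemma near_adapted_range y : adapted_dom y ->
  \forall v \near adapted y,
    [/\ triv_dom t (cinv c v.1), cdom c (cinv c v.1) /\ c (cinv c v.1) = v.1 &
        cdom d (cinv d v.2) /\ d (cinv d v.2) = v.2].
Proof.
case=> ty cy dy.
have c1 : {for adapted y, continuous (@fst 'rV[R]_n 'rV[R]_m)} by exact: cvg_fst.
have c2 : {for adapted y, continuous (@snd 'rV[R]_n 'rV[R]_m)} by exact: cvg_snd.
have h1 : \forall x \near pi y, triv_dom t x.
  by apply: open_nbhs_nbhs; split=> //; exact: triv_open.
have {}h1 := near_comp c1 (near_cinv cy h1).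
have h2 := near_comp c1 (near_cinvK cy).
have h3 := near_comp c2 (near_cinvK dy).
by apply: filterS3 h1 h2 h3 => v.
Qed.

(** The coordinates are smooth because the trivialization is, and their inverse
because the inverse trivialization is. *)
Lemma local_coords_adapted y : adapted_dom y ->
  local_coords adapted adapted_inv y.
Proof.
move=> dy; have [ty cy ddy] := dy.
have cai : {for adapted y, continuous adapted_inv}.
  apply: (@continuous_comp _ _ _
    (fun v : 'rV[R]_n * 'rV[R]_m => (cinv c v.1, cinv d v.2)) (triv_inv t)).
    apply: cvg_pair.
      by apply: cvg_comp; [exact: cvg_fst|exact: cinv_cont].
    by apply: cvg_comp; [exact: cvg_snd|exact: cinv_cont].
  by have [ct _] := triv_inv_smooth t; apply: ct; split=> //=; rewrite cmapK.
split.
- exact: msmooth_adapted.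
- by apply: filterS (near_adapted_dom dy) => q; exact: adapted_invK.
- apply: filterS (near_adapted_range dy) => v [t1 [c1 e1] [d2 e2]].
  by have [] := adaptedK t1 c1 e1 d2 e2.
- exact: cai.
have [_ st] := triv_inv_smooth t.
have := st _ (chart_at_atlas y) (prod_chart c d).
have /[swap]/[apply] : prod_atlas M F (prod_chart c d) by exists c => //; exists d.
move/smooth_on_near; apply.
have : \forall v \near adapted y, cdom (chart_at y) (adapted_inv v).
  apply: near_comp => //; rewrite adapted_invK //.
  by apply: near_cdom; exact: chart_at_dom.
apply: filterS2 (near_adapted_range dy) => v [t1 [c1 e1] [d2 e2]] yv.
exists (cinv c v.1, cinv d v.2) => //.
by rewrite /= /prod_chart /= e1 e2 -surjective_pairing.
Qed.

Lemma near_coords_adapted y : adapted_dom y ->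
  \forall q \near y, local_coords adapted adapted_inv q.
Proof.
by move/near_adapted_dom; apply: filterS => q; exact: local_coords_adapted.
Qed.

Lemma mdiff_adapted y (v : tangent y) : adapted_dom y ->
  mdiff adapted v = (mdiff (c \o pi) v, mdiff (d \o triv_fib t) v).
Proof.
move=> dy; rewrite [LHS]surjective_pairing.
by rewrite -mdiff_fst -?mdiff_snd //; exact: msmooth_adapted.
Qed.

Lemma adapted_inj y (v w : tangent y) : adapted_dom y ->
  mdiff (c \o pi) v = mdiff (c \o pi) w ->
  mdiff (d \o triv_fib t) v = mdiff (d \o triv_fib t) w -> v = w.
Proof.
move=> dy e1 e2; rewrite -(mdiffK v findim_adapted (local_coords_adapted dy)).
rewrite -[RHS](mdiffK w findim_adapted (local_coords_adapted dy)).
by rewrite !mdiff_adapted // e1 e2.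
Qed.

Lemma mdiff_proj_coords_vec y w : adapted_dom y ->
  mdiff (c \o pi) (coords_vec adapted adapted_inv y w) = w.1.
Proof.
move=> dy; have := coords_vecK findim_adapted (local_coords_adapted dy) w.
by rewrite mdiff_adapted // => /(congr1 fst).
Qed.

End Adapted.

Lemma exists_adapted c y : cdom c (pi y) -> exists t d,
  atlas F d /\ adapted_dom t c d y.
Proof.
move=> cy; have [t ty] := fb_triv pi (pi y).
exists t, (chart_at (triv_fib t y)); split; first exact: chart_at_atlas.
by split=> //; exact: chart_at_dom.
Qed.

(** In adapted coordinates the projection is (u, w) |-> u. *)
Lemma tangent_proj_surj y (u : tangent (pi y)) :
  exists v : tangent y, tangent_map pi y v = u.
Proof.
pose c := chart_at (pi y); have ac : atlas M c by exact: chart_at_atlas.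
have cy : cdom c (pi y) by exact: chart_at_dom.
have [t [d [ad dy]]] := exists_adapted cy.
exists (coords_vec (adapted t c d) (adapted_inv t c d) y (mdiff c u, 0)).
apply: (mdiff_chart_inj ac cy); rewrite /= mdiff_proj //.
exact: mdiff_proj_coords_vec.
Qed.

End Bundle.

(** * Horizontal liftings and horizontal subbundles *)

Lemma basis_codomP (K : fieldType) (vT : vectType K) r (f : 'I_r -> vT)
    (U : {vspace vT}) :
  basis_of U (codom f) <->
  [/\ forall i, f i \in U,
      forall v, v \in U -> exists a : 'I_r -> K, v = \sum_i a i *: f i &
      forall a : 'I_r -> K, \sum_i a i *: f i = 0 -> forall i, a i = 0].
Proof.
have -> : codom f = mktuple f :> seq vT by rewrite codomE.
have nthf (i : 'I_r) : (mktuple f)`_i = f i by rewrite -tnth_nth tnth_mktuple.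
split=> [bU|[fU sU fr]].
  split=> [i|v vU|a a0].
  - by apply: (basis_mem bU); rewrite -(tnth_mktuple f i) mem_tnth.
  - exists (fun i => coord (mktuple f) i v); rewrite {1}(coord_basis bU vU).
    by apply: eq_bigr => i _; rewrite nthf.
  - apply/freeP; first exact: basis_free bU.
    by rewrite -[RHS]a0; apply: eq_bigr => i _; rewrite nthf.
apply/andP; split.
  rewrite eqEsubv; apply/andP; split.
    by apply/span_subvP => _ /mapP[i _ ->]; exact: fU.
  apply/subvP => v /sU[a ->]; apply: memv_suml => i _; apply: memvZ.
  by apply: memv_span; rewrite -(tnth_mktuple f i) mem_tnth.
apply/freeP => a a0; apply: fr; rewrite -[RHS]a0.
by apply: eq_bigr => i _; rewrite nthf.
Qed.

Lemma unitmx_rows (K : fieldType) n (P : 'M[K]_n) :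
  (forall a : 'rV_n, a *m P = 0 -> a = 0) -> P \in unitmx.
Proof.
move=> H; rewrite -row_free_unit -kermx_eq0; apply/rowV0P => v.
by move/sub_kermxP; exact: H.
Qed.

Lemma mulmx_row_combination (K : fieldType) r n (a : 'rV[K]_r)
    (f : 'I_r -> 'rV[K]_n) :
  a *m (\matrix_i f i) = \sum_i a 0 i *: f i.
Proof. by rewrite mulmx_sum_row; apply: eq_bigr => i _; rewrite rowK. Qed.

Section Liftings.
Context {R : realType} {n m k : nat} {M : manifold R n} {F : manifold R m}
  {E : manifold R k}.
Variable pi : fiber_bundle M F E.
Implicit Types (y q : E) (c : chart M 'rV[R]_n) (d : chart F 'rV[R]_m).

(** The lifts of the fields with constant components in a chart of M generate
locally the lifts of all fields, so smoothness is tested on them. *)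
Record lifting := Lifting {
  lf :> forall y : E, 'Hom(tangent (pi y), tangent y);
  lf_section : forall y u, tangent_map pi y (lf y u) = u;
  lf_smooth : forall c (a : 'rV[R]_n) y, atlas M c -> cdom c (pi y) ->
    sec_smooth_at (fun q => lf q (tvec c (pi q) a)) y }.

Lemma lift_eq (L L' : lifting) : (forall y u, L y u = L' y u) -> L = L'.
Proof.
case: L L' => [f fs fm] [f' fs' fm'] /= ff.
have e : f = f'.
  apply: functional_extensionality_dep => y.
  by apply/lfunP => u; exact: ff.
by subst f'; congr Lifting; exact: Prop_irrelevance.
Qed.

Lemma hs_eq (H H' : horizontal_subbundle pi) : (forall y, H y = H' y) -> H = H'.
Proof.
case: H H' => [f f1 f2 f3] [g g1 g2 g3] /= fg.
have e : f = g by apply: functional_extensionality_dep.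
by subst g; congr HorizontalSubbundle; exact: Prop_irrelevance.
Qed.

Lemma lift_vertical (L : lifting) y (v : tangent y) :
  v - L y (tangent_map pi y v) \in vertical pi y.
Proof. by rewrite verticalE linearB /= lf_section subrr. Qed.

Lemma lift_unique (L : lifting) y (v : tangent y) :
  v \in limg (L y) -> v = L y (tangent_map pi y v).
Proof. by move=> /memv_imgP[u _ ->]; rewrite lf_section. Qed.

Section SubbundleOfLift.
Variable L : lifting.

(** The lifts of the coordinate fields of a chart of M form a frame. *)
Fact lift_subbundle : is_subbundle (fun y => limg (L y)).
Proof.
move=> y0; pose c := chart_at (pi y0); have ac : atlas M c by exact: chart_at_atlas.
exists (pi @^-1` cdom c), n, (fun i q => L q (tvec c (pi q) (delta_mx 0 i))).
split=> [|||q cq].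
- by apply: open_proj; exact: cdom_open.
- exact: chart_at_dom.
- move=> i; apply/smooth_sectionE => [|q cq]; last exact: lf_smooth.
  by apply: open_proj; exact: cdom_open.
have sumE (a : 'I_n -> R) : \sum_i a i *: L q (tvec c (pi q) (delta_mx 0 i)) =
    L q (tvec c (pi q) (\row_i a i)).
  rewrite [in RHS]tvec_sum linear_sum; apply: eq_bigr => i _.
  by rewrite linearZ /= mxE.
apply/basis_codomP; split=> [i|_ /memv_imgP[u _ ->]|a].
- by apply: memv_img; exact: memvf.
- exists (mdiff c u 0); rewrite sumE; congr (L q _).
  rewrite -[LHS](tvec_mdiff ac cq) //; congr tvec.
  by apply/rowP => i; rewrite mxE.
rewrite sumE => e i; have := lf_section L (tvec c (pi q) (\row_i a i)).
rewrite e linear0 => /esym/(congr1 (@mdiff _ _ _ _ c (pi q))).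
rewrite mdiff_tvec // mdiff0 => /rowP/(_ i).
by rewrite !mxE.
Qed.

Fact lift_direct y : directv (vertical pi y + limg (L y)).
Proof.
apply/directv_addP; apply/eqP; rewrite -subv0; apply/subvP => v.
rewrite memv_cap => /andP[]; rewrite verticalE => /eqP v0 /lift_unique ->.
by rewrite v0 linear0 mem0v.
Qed.

Fact lift_full y : (vertical pi y + limg (L y))%VS = fullv.
Proof.
apply/eqP; rewrite eqEsubv subvf; apply/subvP => v _.
rewrite -[v](subrK (L y (tangent_map pi y v))).
by apply: memv_add; [exact: lift_vertical|apply: memv_img; exact: memvf].
Qed.

Definition subbundle_of_lift : horizontal_subbundle pi :=
  HorizontalSubbundle lift_subbundle lift_direct lift_full.

End SubbundleOfLift.

Section LiftOfSubbundle.
Variable H : horizontal_subbundle pi.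

(** The kernel of the projection is the vertical space, which meets H y trivially. *)
Lemma hs_unique y (h h' : tangent y) : h \in H y -> h' \in H y ->
  tangent_map pi y h = tangent_map pi y h' -> h = h'.
Proof.
move=> hH h'H e; apply/eqP; rewrite -subr_eq0.
have /directv_addP HV := hs_direct H y.
have : h - h' \in (vertical pi y :&: H y)%VS.
  by rewrite memv_cap verticalE linearB /= e subrr eqxx memvB.
by rewrite HV memv0.
Qed.

(** [(tangent_map pi y)^-1] is some linear right inverse of the projection, made
horizontal by projecting along the vertical space. *)
Definition horizontal_lift y : 'Hom(tangent (pi y), tangent y) :=
  (linfun (daddv_pi (H y) (vertical pi y)) \o (tangent_map pi y)^-1)%VF.

Lemma tangent_proj_invK y u : tangent_map pi y ((tangent_map pi y)^-1%VF u) = u.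
Proof.
rewrite limg_lfunVK //; have [v <-] := tangent_proj_surj u.
by apply: memv_img; exact: memvf.
Qed.

Lemma horizontal_lift_in y u : horizontal_lift y u \in H y.
Proof. by rewrite comp_lfunE lfunE memv_pi. Qed.

Lemma horizontal_lift_section y u :
  tangent_map pi y (horizontal_lift y u) = u.
Proof.
rewrite comp_lfunE; set v := (_^-1%VF u); rewrite [linfun _ v]lfunE.
have HV : (H y :&: vertical pi y = 0)%VS.
  by rewrite capvC; apply/directv_addP; exact: hs_direct.
have := daddv_pi_add (w := v) HV; rewrite addvC hs_full memvf => /(_ isT) e.
have : daddv_pi (vertical pi y) (H y) v \in vertical pi y by exact: memv_pi.
rewrite verticalE => /eqP v0.
by rewrite -[RHS]tangent_proj_invK -/v -[in RHS]e linearD /= v0 addr0.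
Qed.

(** Local frames of H thus have n members, and the matrix of their projections is
square. *)
Lemma dim_horizontal y : \dim (H y) = n.
Proof.
have e1 := limg_ker_dim (tangent_map pi y) fullv.
have e2 : limg (tangent_map pi y) = fullv.
  apply/eqP; rewrite eqEsubv subvf; apply/subvP => u _.
  by have [v <-] := tangent_proj_surj u; apply: memv_img; exact: memvf.
have /directv_addP HV := hs_direct H y.
have := dimv_disjoint_sum HV; rewrite hs_full -e1 e2 capfv.
move/addnI => <-; by rewrite dimvf /dim /= mul1n.
Qed.

(** With P the matrix of the projections of a frame s of H, the lift of the vector
with components a is the combination of s with coefficients a P^-1. *)
Fact horizontal_lift_smooth c (a : 'rV[R]_n) y0 : atlas M c -> cdom c (pi y0) ->
  sec_smooth_at (fun q => horizontal_lift q (tvec c (pi q) a)) y0.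
Proof.
move=> ac cy0; have [U [r [s [oU Uy0 ss bs]]]] := hs_subbundle H y0.
have rn : r = n.
  have := size_basis (bs y0 Uy0) => /=.
  by rewrite dim_horizontal card_ord => ->.
subst r.
pose P q : 'M[R]_n := \matrix_i mdiff (c \o pi) (s i q).
have Pu q : U q -> cdom c (pi q) -> P q \in unitmx.
  move=> Uq cq; apply: unitmx_rows => v; rewrite mulmx_row_combination => e.
  have /basis_codomP[sH _ sfree] := bs q Uq.
  have : \sum_i v 0 i *: s i q = 0.
    apply: (@hs_unique q); rewrite ?mem0v //.
      by apply: memv_suml => i _; apply: memvZ.
    rewrite linear0; apply: (mdiff_chart_inj ac cq); rewrite /= mdiff_proj //.
    rewrite mdiff_sum mdiff0 -[RHS]e; apply: eq_bigr => i _.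
    by rewrite mdiffZ.
  by move/(sfree (v 0)) => v0; apply/rowP => i; rewrite v0 mxE.
have sP : msmooth_at P y0.
  apply: msmooth_at_mx => i j.
  apply: (msmooth_at_ext (g := fun q => mdiff (c \o pi) (s i q) 0 j : R^o)).
    by move=> q; rewrite mxE.
  apply: msmooth_at_entry; apply: sec_smooth_mdiff; last exact: msmooth_proj.
  by have /smooth_sectionE := ss i; apply.
have sPi := msmooth_at_invmx (Pu _ Uy0 cy0) sP.
apply: (sec_smooth_eq (Y := fun q => \sum_i (a *m invmx (P q)) 0 i *: s i q)).
  have nU : \forall q \near y0, U q by exact: open_nbhs_nbhs.
  have nc : \forall q \near y0, cdom c (pi q).
    by apply: open_nbhs_nbhs; split=> //; apply: open_proj; exact: cdom_open.
  apply: filterS2 nU nc => q Uq cq; have /basis_codomP[sH _ _] := bs q Uq.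
  apply: hs_unique; first exact: horizontal_lift_in.
    by apply: memv_suml => i _; apply: memvZ.
  rewrite horizontal_lift_section; apply: (mdiff_chart_inj ac cq).
  rewrite /= mdiff_tvec // mdiff_proj // mdiff_sum.
  rewrite -[LHS](mulmxKV (Pu q Uq cq)) mulmx_row_combination.
  by apply: eq_bigr => i _; rewrite mdiffZ.
apply: sec_smooth_sum => i; apply: sec_smoothZ.
  by apply: msmooth_at_entry; apply: msmooth_at_mulmx => //; exact: msmooth_at_cst.
by have /smooth_sectionE := ss i; apply.
Qed.

Definition lift_of_subbundle : lifting :=
  Lifting horizontal_lift_section horizontal_lift_smooth.

Lemma lift_of_subbundle_in y u : lift_of_subbundle y u \in H y.
Proof. exact: horizontal_lift_in. Qed.

End LiftOfSubbundle.

Lemma subbundle_of_liftK : cancel subbundle_of_lift lift_of_subbundle.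
Proof.
move=> L; apply: lift_eq => y u.
apply: (hs_unique (H := subbundle_of_lift L)); first exact: lift_of_subbundle_in.
  by apply: memv_img; exact: memvf.
by rewrite !lf_section.
Qed.

Lemma lift_of_subbundleK : cancel lift_of_subbundle subbundle_of_lift.
Proof.
move=> H; apply: hs_eq => y; apply/vspaceP => v; apply/idP/idP.
  by move=> /memv_imgP[u _ ->]; exact: lift_of_subbundle_in.
move=> vH; have -> : v = lift_of_subbundle H y (tangent_map pi y v).
  by apply: (hs_unique (H := H)) => //; [exact: lift_of_subbundle_in|rewrite lf_section].
by apply: memv_img; exact: memvf.
Qed.

End Liftings.

(** * Connection forms *)

Section Tensorial.
Context {R : realType} {n : nat} {M : manifold R n}.
Implicit Types (p q : M) (X Y Z : vector_field M).

Lemma vf_eq X Y : (forall p, X p = Y p) -> X = Y.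
Proof.
case: X Y => [f fs] [g gs] /= fg.
have e : f = g by apply: functional_extensionality_dep.
by subst g; congr VectorField; exact: Prop_irrelevance.
Qed.

Lemma vf_sec_smooth X p : sec_smooth_at X p.
Proof. by have /smooth_sectionE := vf_smooth X; apply => //; exact: openT. Qed.

Fact msmooth_smooth_funT (f : M -> R^o) : (forall p, msmooth_at f p) ->
  smooth_fun (atlas M) setT f.
Proof. by move=> sf; apply/smooth_funE => [|p _]; [exact: openT|exact: sf]. Qed.

Fact zero_smooth : smooth_section setT (fun p : M => (0 : tangent p)).
Proof.
apply/smooth_sectionE => [|p _]; first exact: openT.
by apply: msmooth_at_ext (msmooth_at_cst 0 p) => q; rewrite mdiff0.
Qed.

Definition vf0 : vector_field M := VectorField zero_smooth.

Variable T : vector_field M -> vector_field M.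
Hypothesis linT : forall (f : smooth_function M) X Y,
  T (vf_lin f X Y) = vf_lin f (T X) (T Y).

Let sf_cst (a : R) : smooth_function M :=
  SmoothFunction (msmooth_smooth_funT (fun p => @msmooth_at_cst _ _ M R^o a p)).

Lemma tensor0 p : T vf0 p = 0.
Proof.
have : T (vf_lin (sf_cst 1) vf0 vf0) p = T vf0 p + T vf0 p.
  by rewrite linT /= scale1r.
have -> : vf_lin (sf_cst 1) vf0 vf0 = vf0.
  by apply: vf_eq => q /=; rewrite scale1r addr0.
by move/eqP; rewrite -subr_eq0 opprD addNKr oppr_eq0 => /eqP.
Qed.

Lemma tensor_sum (I : Type) (r : seq I) (f : I -> smooth_function M)
    (X : I -> vector_field M) p :
  T (foldr (fun i Y => vf_lin (f i) (X i) Y) vf0 r) p =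
  \sum_(i <- r) f i p *: T (X i) p.
Proof.
elim: r => [|i r IH]; first by rewrite big_nil tensor0.
by rewrite big_cons /= linT /= IH.
Qed.

(** Let b be a bump function with b p = 1, supported in a chart domain. Then b^2 Z
is the combination of the global fields b d/dx^i with the global coefficients
b Z^i, and all these coefficients vanish at p. *)
Lemma tensor_vanish Z p : Z p = 0 -> T Z p = 0.
Proof.
move=> Zp; pose c := chart_at p; have ac : atlas M c by exact: chart_at_atlas.
have cp : cdom c p by exact: chart_at_dom.
have [b [sb b1 bU]] := exists_bump (@cdom_open _ _ _ c) cp.
have sX i : smooth_section setT (fun q => b q *: tvec c q (delta_mx 0 i)).
  apply: (@sec_smooth_bump _ _ _ (cdom c)) => // q cq.
  apply: (@sec_smooth_coords_vec _ _ _ _ c (cinv c) (fun _ => delta_mx 0 i)).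
  - exact: findim_mx.
  - exact: near_chart_coords.
  - exact: msmooth_at_cst.
have sf i : smooth_fun (atlas M) setT (fun q => b q *: (mdiff c (Z q) 0 i : R^o)).
  apply: msmooth_smooth_funT; apply: (@msmooth_at_bump _ _ _ _ (cdom c)) => // q cq.
  apply: msmooth_at_entry; apply: sec_smooth_mdiff; first exact: vf_sec_smooth.
  exact: msmooth_at_chart.
have sb2 : smooth_fun (atlas M) setT (fun q => b q *: b q).
  by apply: msmooth_smooth_funT => q; exact: msmooth_atZ.
pose X i := VectorField (sX i); pose f i := SmoothFunction (sf i).
have e : vf_lin (SmoothFunction sb2) Z vf0 =
    foldr (fun i Y => vf_lin (f i) (X i) Y) vf0 (index_enum 'I_n).
  have s0 : forall r q, foldr (fun i Y => vf_lin (f i) (X i) Y) vf0 r q =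
      \sum_(i <- r) f i q *: X i q.
    by elim=> [|i r IH] q /=; rewrite ?big_nil ?big_cons ?IH.
  apply: vf_eq => q; rewrite s0 /= addr0.
  have [cq|cq] := pselect (cdom c q); last first.
    have bq := nbhs_singleton (bU q cq).
    by rewrite bq !scale0r big1 // => i _; rewrite !scale0r.
  rewrite -{1}[Z q](tvec_mdiff ac cq) tvec_sum scaler_sumr.
  apply: eq_bigr => i _; rewrite !scalerA; congr (_ *: _).
  by rewrite /GRing.scale /= mulrAC.
have : T (vf_lin (SmoothFunction sb2) Z vf0) p = T Z p.
  by rewrite linT /= tensor0 addr0 b1 /GRing.scale /= mulr1 -/(_ *: _) scale1r.
rewrite e tensor_sum => <-; rewrite big1 // => i _.
by rewrite /= Zp mdiff0 mxE scaler0 scale0r.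
Qed.

(** The difference of X and Y vanishes at p. *)
Lemma tensor_pointwise X Y p : X p = Y p -> T X p = T Y p.
Proof.
move=> XY; have : T (vf_lin (sf_cst (-1)) X Y) p = 0.
  by apply: tensor_vanish; rewrite /= XY scaleN1r addNr.
by rewrite linT /= scaleN1r addrC => /subr0_eq.
Qed.

Lemma tensor_lin X Y Z a p : X p = a *: Y p + Z p -> T X p = a *: T Y p + T Z p.
Proof.
by move=> e; rewrite (@tensor_pointwise X (vf_lin (sf_cst a) Y Z)) // linT.
Qed.

End Tensorial.

Section Forms.
Context {R : realType} {n m k : nat} {M : manifold R n} {F : manifold R m}
  {E : manifold R k}.
Variable pi : fiber_bundle M F E.
Implicit Types (y q : E) (c : chart M 'rV[R]_n) (d : chart F 'rV[R]_m).

(** The field of constant adapted components w only makes sense locally; being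
multiplied by b makes it global and keeps its direction. *)
Lemma adapted_extension t c d y (w : 'rV[R]_n * 'rV[R]_m) :
  atlas M c -> atlas F d -> adapted_dom (pi := pi) t c d y ->
  exists (X : vector_field E) (b : E -> R^o),
    [/\ forall q, X q = b q *: coords_vec (adapted t c d) (adapted_inv t c d) q w,
        forall q, msmooth_at b q, b y = 1 &
        forall q, ~ adapted_dom t c d q -> b q = 0].
Proof.
move=> ac ad dy; have oU := @open_adapted_dom _ _ _ _ _ _ _ pi t c d.
have [b [sb b1 bU]] := exists_bump oU dy.
have sX : smooth_section setT
    (fun q => b q *: coords_vec (adapted t c d) (adapted_inv t c d) q w).
  apply: (@sec_smooth_bump _ _ _ (adapted_dom t c d)) => // q dq.
  apply: (@sec_smooth_coords_vec _ _ _ _ _ _ (fun _ => w)).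
  - exact: findim_adapted.
  - exact: near_coords_adapted.
  - exact: msmooth_at_cst.
by exists (VectorField sX), b; split=> // q /bU/nbhs_singleton.
Qed.

(** A vector is vertical when its first adapted components are 0, a condition that
is kept by fields with constant components. *)
Lemma vf_extension y (v : tangent y) : exists2 X : vector_field E, X y = v &
  v \in vertical pi y -> forall q, X q \in vertical pi q.
Proof.
pose c := chart_at (pi y); have ac : atlas M c by exact: chart_at_atlas.
have cy : cdom c (pi y) by exact: chart_at_dom.
have [t [d [ad dy]]] := exists_adapted cy.
have [X [b [Xe _ b1 b0]]] := adapted_extension (mdiff (adapted t c d) v) ac ad dy.
exists X => [|vV q].
  rewrite Xe b1 scale1r; apply: mdiffK; first exact: findim_adapted.
  exact: local_coords_adapted.
rewrite Xe; have [dq|/b0 ->] := pselect (adapted_dom t c d q); last first.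
  by rewrite scale0r mem0v.
have cq : cdom c (pi q) by case: dq.
apply: memvZ; apply/(verticalP _ ac cq); rewrite mdiff_proj_coords_vec //.
by rewrite mdiff_adapted //=; apply/(verticalP _ ac cy).
Qed.

Section FormOfLift.
Variable L : lifting pi.

Fact form_of_lift_smooth (X : vector_field E) :
  smooth_section setT (fun y => L y (tangent_map pi y (X y))).
Proof.
apply/smooth_sectionE => [|y _]; first exact: openT.
pose c := chart_at (pi y); have ac : atlas M c by exact: chart_at_atlas.
have cy : cdom c (pi y) by exact: chart_at_dom.
apply: (sec_smooth_eq (Y := fun q =>
   \sum_i (mdiff (c \o pi) (X q) 0 i : R^o) *: L q (tvec c (pi q) (delta_mx 0 i)))).
  have : \forall q \near y, cdom c (pi q).
    by apply: open_nbhs_nbhs; split=> //; apply: open_proj; exact: cdom_open.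
  apply: filterS => q cq.
  rewrite -{1}[tangent_map pi q _](tvec_mdiff ac cq) mdiff_proj // tvec_sum.
  by rewrite linear_sum; apply: eq_bigr => i _; rewrite linearZ.
apply: sec_smooth_sum => i; apply: sec_smoothZ; last exact: lf_smooth.
apply: msmooth_at_entry; apply: sec_smooth_mdiff; first exact: vf_sec_smooth.
exact: msmooth_proj.
Qed.

Definition lift_operator (X : vector_field E) : vector_field E :=
  VectorField (form_of_lift_smooth X).

Fact lift_operator_linear (f : smooth_function E) (X Y : vector_field E) :
  lift_operator (vf_lin f X Y) = vf_lin f (lift_operator X) (lift_operator Y).
Proof. by apply: vf_eq => y /=; rewrite !linearP. Qed.

Fact lift_operator_vertical (X : vector_field E) :
  (forall y, X y \in vertical pi y) -> forall y, lift_operator X y = 0.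
Proof.
by move=> XV y /=; have := XV y; rewrite verticalE => /eqP ->; rewrite linear0.
Qed.

Definition semibasic_of_lift : semibasic_form pi :=
  SemibasicForm lift_operator_linear lift_operator_vertical.

Fact semibasic_of_lift_pull (alpha : one_form E) : semibasic pi alpha ->
  form_pull semibasic_of_lift alpha = form_eval alpha.
Proof.
move=> sa; apply/funext => X; apply/funext => y.
rewrite /form_pull /form_eval /=; apply/eqP; rewrite eq_sym -subr_eq0.
by rewrite -linearB /=; apply/eqP/sa; exact: lift_vertical.
Qed.

Definition form_of_lift : connection_form pi :=
  ConnectionForm semibasic_of_lift_pull.

End FormOfLift.

Lemma cf_eq (N N' : connection_form pi) :
  (forall X y, N X y = N' X y) -> N = N'.
Proof.
case: N N' => [[f f1 f2] f3] [[g g1 g2] g3] /= fg.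
have e : f = g by apply/funext => X; apply: vf_eq => y; exact: fg.
subst g; have e1 := Prop_irrelevance f1 g1; have e2 := Prop_irrelevance f2 g2.
by subst g1 g2; congr ConnectionForm; exact: Prop_irrelevance.
Qed.

Section LiftOfForm.
Variable N : connection_form pi.

Definition field_through y (v : tangent y) : vector_field E :=
  projT1 (cid2 (vf_extension v)).

Lemma field_throughE y (v : tangent y) : field_through v y = v.
Proof. by rewrite /field_through; case: cid2. Qed.

Lemma field_through_vertical y (v : tangent y) : v \in vertical pi y ->
  forall q, field_through v q \in vertical pi q.
Proof. by rewrite /field_through; case: cid2. Qed.

Definition form_at y (v : tangent y) : tangent y := N (field_through v) y.

Lemma form_atE (X : vector_field E) y : N X y = form_at (X y).
Proof.
by apply: tensor_pointwise; [exact: sb_linear|rewrite field_throughE].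
Qed.

Fact form_at_linear y : linear (@form_at y).
Proof.
move=> a v w; apply: tensor_lin; first exact: sb_linear.
by rewrite !field_throughE.
Qed.

Lemma form_at_vertical y (v : tangent y) : v \in vertical pi y -> form_at v = 0.
Proof. by move=> vV; apply: sb_vertical; exact: field_through_vertical. Qed.

(** The semibasic forms b d(x^i o pi), with b a bump function, see all the
components of the projection of a vector. *)
Lemma tangent_map_form y (v : tangent y) :
  tangent_map pi y (form_at v) = tangent_map pi y v.
Proof.
pose c := chart_at (pi y); have ac : atlas M c by exact: chart_at_atlas.
have cy : cdom c (pi y) by exact: chart_at_dom.
apply: (mdiff_chart_inj ac cy); rewrite /= !mdiff_proj //.
pose U := pi @^-1` cdom c; have oU : open U by apply: open_proj; exact: cdom_open.
have [b [sb b1 bU]] := exists_bump oU cy; apply/rowP => i.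
(* alpha = b d(x^i o pi), with x^i the i-th coordinate of the chart c. *)
pose g q : R^o := c (pi q) 0 i.
have sg q : U q -> msmooth_at g q.
  by move=> Uq; apply: (msmooth_at_entry (f := c \o pi)); exact: msmooth_proj.
have gE q (w : tangent q) : U q -> mdiff g w = mdiff (c \o pi) w 0 i.
  by move=> Uq; apply: (mdiff_entry (f := c \o pi)); exact: msmooth_proj.
pose al q : 'Hom(tangent q, R^o) := linfun (fun w : tangent q => b q *: mdiff g w).
have alE q (w : tangent q) : al q w = b q *: mdiff g w.
  have lw : linear (fun w : tangent q => b q *: mdiff g w).
    by move=> a u u'; rewrite mdiffP scalerDr !scalerA [b q * a]mulrC.
  pose LL : {linear tangent q -> R^o} :=
    HB.pack (fun w : tangent q => b q *: mdiff g w) (GRing.isLinear.Build _ _ _ _ _ lw).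
  by rewrite (lfunE LL).
have sal (e : chart E 'rV[R]_k) (a : 'rV[R]_k) : atlas E e ->
    smooth_fun (atlas E) (cdom e) (fun q => al q (tvec e q a)).
  move=> ae; apply: msmooth_smooth_fun => q cq.
  apply: (msmooth_at_ext (g := fun q => b q *: mdiff g (tvec e q a))) => //.
  have [Uq|/bU bq] := pselect (U q); last first.
    apply: msmooth_at_eq (msmooth_at_cst 0 q).
    by apply: filterS bq => r ->; rewrite scale0r.
  apply: msmooth_atZ => //; apply: sec_smooth_mdiff; last exact: sg.
  apply: (@sec_smooth_coords_vec _ _ _ _ e (cinv e) (fun _ => a)).
  - exact: findim_mx.
  - exact: near_chart_coords.
  - exact: msmooth_at_cst.
pose alpha := OneForm sal.
have sa : semibasic pi alpha.
  move=> q w wV; rewrite /= alE.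
  have [Uq|/bU/nbhs_singleton ->] := pselect (U q); last by rewrite scale0r.
  by rewrite gE //; have /(verticalP _ ac Uq) -> := wV; rewrite mxE scaler0.
have := congr1 (fun h => h (field_through v) y) (cf_pull N sa).
rewrite /form_pull /form_eval /= field_throughE !alE b1 !scale1r !gE //.
Qed.

(** The right inverse of the projection picks some vector over u; by
[form_lift_proj] every other choice gives the same value. *)
Definition form_lift y : 'Hom(tangent (pi y), tangent y) :=
  let LL : {linear tangent y -> tangent y} :=
    HB.pack (@form_at y) (GRing.isLinear.Build _ _ _ _ _ (@form_at_linear y)) in
  (linfun LL \o (tangent_map pi y)^-1)%VF.

Lemma form_liftE y u : form_lift y u = form_at ((tangent_map pi y)^-1%VF u).
Proof. by rewrite comp_lfunE lfunE. Qed.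

(** Two vectors with the same projection differ by a vertical vector, on which the
form vanishes. *)
Lemma form_lift_proj y (v : tangent y) :
  form_lift y (tangent_map pi y v) = form_at v.
Proof.
rewrite form_liftE; set w := (_^-1%VF _).
have : form_at ((-1) *: v + w) = 0.
  apply: form_at_vertical; rewrite verticalE linearP /=.
  by rewrite tangent_proj_invK scaleN1r addNr.
by rewrite form_at_linear scaleN1r addrC => /subr0_eq.
Qed.

Fact form_lift_section y u : tangent_map pi y (form_lift y u) = u.
Proof. by rewrite form_liftE tangent_map_form tangent_proj_invK. Qed.

(** The local field with constant adapted components (a, 0) projects to the field
to be lifted. Its product X with a bump function b is global, so N applies to
it and gives b times the lift; near y, b can be divided out. *)
Fact form_lift_smooth c (a : 'rV[R]_n) y : atlas M c -> cdom c (pi y) ->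
  sec_smooth_at (fun q => form_lift q (tvec c (pi q) a)) y.
Proof.
move=> ac cy; have [t [d [ad dy]]] := exists_adapted cy.
have [X [b [Xe sb b1 _]]] := adapted_extension (a, 0) ac ad dy.
have b0 : b y != 0 by rewrite b1 oner_neq0.
apply: (sec_smooth_eq (Y := fun q => ((b q)^-1 : R^o) *: N X q)).
  have nb := near_neq0 (msmooth_at_continuous (sb y)) b0.
  apply: filterS2 nb (near_adapted_dom dy) => q bq dq.
  have cq : cdom c (pi q) by case: dq.
  rewrite form_atE -form_lift_proj Xe linearZ /= linearZ /= scalerA mulVf // scale1r.
  congr (form_lift q _); apply: (mdiff_chart_inj ac cq).
  by rewrite /= mdiff_tvec // mdiff_proj // mdiff_proj_coords_vec.
by apply: sec_smoothZ; [exact: msmooth_atV|exact: vf_sec_smooth].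
Qed.

Definition lift_of_form : lifting pi := Lifting form_lift_section form_lift_smooth.

Lemma lift_of_formE (X : vector_field E) y :
  lift_of_form y (tangent_map pi y (X y)) = N X y.
Proof. by rewrite form_atE -form_lift_proj. Qed.

End LiftOfForm.

Lemma form_of_liftK : cancel form_of_lift lift_of_form.
Proof.
move=> L; apply: lift_eq => y u.
have := lift_of_formE (form_of_lift L) (field_through (L y u)) y.
by rewrite /= !field_throughE !lf_section.
Qed.

Lemma lift_of_formK : cancel lift_of_form form_of_lift.
Proof. by move=> N; apply: cf_eq => X y; rewrite -[RHS]lift_of_formE. Qed.

End Forms.

(** * Jets of sections *)

Lemma mulmx_linear_rows (K : fieldType) n m (L : 'rV[K]_n -> 'rV[K]_m)
    (u : 'rV[K]_n) : linear L -> u *m (\matrix_i L (delta_mx 0 i)) = L u.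
Proof.
move=> lL; pose LL : {linear _ -> _} := HB.pack L (GRing.isLinear.Build _ _ _ _ L lL).
rewrite mulmx_row_combination {2}[u]row_sum_delta -[RHS]/(LL _) linear_sum.
by apply: eq_bigr => i _; rewrite linearZ.
Qed.

Section Jets.
Context {R : realType} {n m k : nat} {M : manifold R n} {F : manifold R m}
  {E : manifold R k}.
Variable pi : fiber_bundle M F E.
Implicit Types (y q : E) (c : chart M 'rV[R]_n) (d : chart F 'rV[R]_m).

Lemma local_section_smap (phi : local_section pi) x : ls_dom phi x -> smap_at phi x.
Proof.
by move=> dx; have /smooth_map_smap := ls_smooth phi; apply => //; exact: ls_open.
Qed.

Lemma near_local_section (phi : local_section pi) x : ls_dom phi x ->
  \forall z \near x, pi (phi z) = z.
Proof.
move=> dx; have : \forall z \near x, ls_dom phi z.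
  by apply: open_nbhs_nbhs; split=> //; exact: ls_open.
by apply: filterS => z; exact: ls_section.
Qed.

(** Differentiating pi o phi = id. *)
Lemma tangent_section (phi : local_section pi) y (u : tangent (pi y)) :
  ls_dom phi (pi y) -> phi (pi y) = y ->
  tangent_map pi y (tangent_map phi (pi y) u) = u.
Proof.
move=> dx e; pose c := chart_at (pi y); have ac : atlas M c by exact: chart_at_atlas.
have cy : cdom c (pi y) by exact: chart_at_dom.
apply: (mdiff_chart_inj ac cy); rewrite /= mdiff_proj //.
move: (local_section_smap dx) (msmooth_proj ac cy) => sphi scp.
have -> : mdiff (c \o pi) (tangent_map phi (pi y) u : tangent y) =
    @mdiff _ _ _ _ (c \o pi) (phi (pi y)) (tangent_map phi (pi y) u).
  by rewrite e.
have {}scp : msmooth_at (c \o pi) (phi (pi y)) by rewrite e.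
rewrite (mdiff_tangent_map u sphi scp).
apply: mdiff_eq; last exact: msmooth_at_chart.
by apply: filterS (near_local_section dx) => z /= ->.
Qed.

(** The natural coordinates of a jet are the fibre components of the images of the
coordinate vectors of M. *)
Lemma jacobian_section t c d y (phi : local_section pi) (u : 'rV[R]_n) :
  atlas M c -> atlas F d -> adapted_dom (pi := pi) t c d y ->
  ls_dom phi (pi y) -> phi (pi y) = y ->
  u *m 'J (d \o triv_fib t \o phi \o cinv c) (c (pi y)) =
  mdiff (d \o triv_fib t) (tangent_map phi (pi y) (tvec c (pi y) u) : tangent y).
Proof.
move=> ac ad dy dx e; have [ty cy ddy] := dy.
have sphi := local_section_smap dx; have sf := msmooth_fib ad dy.
have -> : mdiff (d \o triv_fib t)
      (tangent_map phi (pi y) (tvec c (pi y) u) : tangent y) =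
    @mdiff _ _ _ _ (d \o triv_fib t) (phi (pi y))
      (tangent_map phi (pi y) (tvec c (pi y) u)).
  by rewrite e.
have sfp : msmooth_at (d \o triv_fib t) (phi (pi y)) by rewrite e.
rewrite (mdiff_tangent_map _ sphi sfp).
rewrite (mdiff_coords_vec (findim_mx _ _) (local_coords_chart ac cy)) //.
  by rewrite /jacobian mul_rV_lin1.
exact: smap_at_comp.
Qed.

(** In adapted coordinates the section is affine, with the slope prescribed
by A. *)
Lemma exists_section y (A : 'Hom(tangent (pi y), tangent y)) :
  (forall u, tangent_map pi y (A u) = u) ->
  exists phi : local_section pi, [/\ ls_dom phi (pi y), phi (pi y) = y &
    forall u, tangent_map phi (pi y) u = A u].
Proof.
move=> piA; pose x := pi y; pose c := chart_at x.
have ac : atlas M c by exact: chart_at_atlas.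
have cy : cdom c (pi y) by exact: chart_at_dom.
have [t [d [ad dy]]] := exists_adapted cy; have [ty _ ddy] := dy.
pose f := d \o triv_fib t; pose a := adapted t c d; pose ai := adapted_inv t c d.
pose B : 'M[R]_(n, m) :=
  \matrix_i (mdiff f (A (tvec c x (delta_mx 0 i)) : tangent y)).
have BE u : u *m B = mdiff f (A (tvec c x u) : tangent y).
  apply: (mulmx_linear_rows (L := fun u => mdiff f (A (tvec c x u) : tangent y))).
  by move=> s v w; rewrite -mdiffP -linearP; congr (mdiff f (A _)); exact: linearP.
(* The affine map with slope B through f y, in the coordinates c and d. *)
pose z (x' : M) : 'rV[R]_m := (f y - c x *m B) + c x' *m B.
have zx : z x = f y by rewrite /z subrK.
have sz x' : cdom c x' -> msmooth_at z x'.
  move=> cx; apply: msmooth_atD; first exact: msmooth_at_cst.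
  by apply: msmooth_at_mulmx; [exact: msmooth_at_chart|exact: msmooth_at_cst].
pose phi x' := ai (c x', z x').
pose S x' := [/\ triv_dom t x', cdom c x' &
  cdom d (cinv d (z x')) /\ d (cinv d (z x')) = z x'].
have nS : \forall x' \near x, S x'.
  have h1 : \forall x' \near x, triv_dom t x'.
    by apply: open_nbhs_nbhs; split=> //; exact: triv_open.
  have h2 := near_cdom cy.
  have h3 : \forall x' \near x, cdom d (cinv d (z x')) /\ d (cinv d (z x')) = z x'.
    have cz : {for x, continuous z} by apply: msmooth_at_continuous; exact: sz.
    have := near_cinvK ddy; rewrite -[d (triv_fib t y)]zx.
    exact: (near_comp cz).
  by apply: filterS3 h1 h2 h3.
have phiS x' : S x' -> [/\ adapted_dom t c d (phi x'), pi (phi x') = x' &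
    a (phi x') = (c x', z x')].
  case=> t1 c1 [d2 e2]; have e1 : cinv c (c x') = x' by exact: cmapK.
  by have := @adaptedK _ _ _ _ _ _ _ pi t c d (c x', z x'); rewrite /= e1; apply.
have sphi x' : S x' -> smap_at phi x'.
  move=> Sx; have [dp pp ap] := phiS x' Sx; have [_ cx _] := Sx.
  have [_ _ _ cai sai] := local_coords_adapted ac ad dp.
  have sv : msmooth_at (fun x' => (c x', z x')) x'.
    by apply: msmooth_at_pair; [exact: msmooth_at_chart|exact: sz].
  split.
    apply: (@continuous_comp _ _ _ (fun x' => (c x', z x')) ai).
      exact: msmooth_at_continuous.
    by rewrite -ap.
  apply: (msmooth_at_comp (f := fun x' => (c x', z x'))
    (g := chart_at (phi x') \o ai)) => //.
    exact: findim_adapted.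
  by rewrite -ap.
have /near_open[U [oU Ux US]] := nS.
have lsS : smooth_map (atlas M) (atlas E) U phi.
  by apply/smooth_map_smap => // x' /US; exact: sphi.
have lss x' : U x' -> pi (phi x') = x' by move=> /US/phiS[].
have Sx := US x Ux.
have phix : phi x = y by rewrite /phi zx; exact: adapted_invK.
exists (LocalSection oU lsS lss); split=> //= u.
have tpi := @tangent_section (LocalSection oU lsS lss) y u Ux phix.
apply: (adapted_inj ac ad dy).
  by rewrite -!mdiff_proj // piA tpi.
have sfp : msmooth_at f (phi x) by rewrite phix; exact: (msmooth_fib ad dy).
have -> : mdiff f (tangent_map phi x u : tangent y) =
    @mdiff _ _ _ _ f (phi x) (tangent_map phi x u) by rewrite phix.
rewrite (mdiff_tangent_map u (sphi x Sx) sfp).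
have -> : @mdiff _ _ _ _ (f \o phi) x u = @mdiff _ _ _ _ z x u.
  apply: mdiff_eq; last exact: sz.
  apply: filterS nS => x' /phiS[_ _]; rewrite /a /adapted /f /= => -[_ ->] //.
have -> : @mdiff _ _ _ _ z x u = @mdiff _ _ _ _ c x u *m B.
  have scx := msmooth_at_chart ac cy.
  rewrite mdiff_shift; last by apply: msmooth_at_mulmx => //; exact: msmooth_at_cst.
  apply: (mdiff_linear (L := fun v : 'rV[R]_n => v *m B)) => // [s v w|v].
    by rewrite mulmxDl scalemxAl.
  apply: smooth_at_continuous; apply: smooth_at_mulmx; last exact: smooth_at_cst.
  exact: smooth_at_id.
by rewrite BE tvec_mdiff.
Qed.

Lemma jet_repP (j : jet1 pi) : [/\ ls_dom (jet_rep j) (pi (jet_pt j)),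
  jet_rep j (pi (jet_pt j)) = jet_pt j &
  jet_set j = jet_class (pi (jet_pt j)) (jet_rep j)].
Proof. by rewrite /jet_rep; case: cid. Qed.

Lemma jet_mem (j : jet1 pi) (phi : local_section pi) : jet_set j phi ->
  [/\ ls_dom phi (pi (jet_pt j)), phi (pi (jet_pt j)) = jet_pt j &
    forall u, tangent_map phi (pi (jet_pt j)) u =
              tangent_map (jet_rep j) (pi (jet_pt j)) u].
Proof. by have [d e ->] := jet_repP j; case=> d' e' h; split=> //; rewrite e'. Qed.

(** A jet is determined by its base point and by the differential of one
representative. Both differentials end in spaces of components, so they can be
compared although the points phi (pi y) are only provably equal. *)
Lemma jet_eq (j j' : jet1 pi) : jet_pt j = jet_pt j' ->
  (forall u, tangent_map (jet_rep j) (pi (jet_pt j)) u =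
             tangent_map (jet_rep j') (pi (jet_pt j)) u :> 'rV[R]_k) -> j = j'.
Proof.
move=> ep et.
have es : jet_set j = jet_set j'.
  have [d e ->] := jet_repP j; have := jet_repP j'.
  rewrite -ep => -[d' e' ->].
  rewrite predeqE => psi.
  have ee : jet_rep j (pi (jet_pt j)) = jet_rep j' (pi (jet_pt j)).
    exact: (etrans e (esym e')).
  split=> -[dp pp tp].
    split; [exact: dp|exact: (etrans pp ee)|] => v.
    exact: (etrans (tp v) (et v)).
  split; [exact: dp|exact: (etrans pp (esym ee))|] => v.
  exact: (etrans (tp v) (esym (et v))).
clear et; case: j j' ep es => [p s hs] [p' s' hs'] /= ep es.
by subst p' s'; congr Jet1; exact: Prop_irrelevance.
Qed.

Lemma js_eq (Psi Psi' : jet_section pi) : (forall y, Psi y = Psi' y) -> Psi = Psi'.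
Proof.
case: Psi Psi' => [f f1 f2] [g g1 g2] /= fg.
have e : f = g by apply/funext.
by subst g; congr JetSection; exact: Prop_irrelevance.
Qed.

Section LiftOfJet.
Variable Psi : jet_section pi.

Lemma js_pt y : jet_pt (Psi y) = y.
Proof. exact: (congr1 (fun h => h y) (js_section Psi)). Qed.

Definition jet_lift y : 'Hom(tangent (pi y), tangent y) :=
  tangent_map (jet_rep (Psi y)) (pi y).

Lemma jet_rep_js y : ls_dom (jet_rep (Psi y)) (pi y) /\
  jet_rep (Psi y) (pi y) = y.
Proof. by have [] := jet_repP (Psi y); rewrite js_pt. Qed.

Fact jet_lift_section y u : tangent_map pi y (jet_lift y u) = u.
Proof. by have [d e] := jet_rep_js y; exact: tangent_section. Qed.

(** The adapted components of the lift are a and the product of a with the matrix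
of jet coordinates. *)
Fact jet_lift_smooth c (a : 'rV[R]_n) y : atlas M c -> cdom c (pi y) ->
  sec_smooth_at (fun q => jet_lift q (tvec c (pi q) a)) y.
Proof.
move=> ac cy; have [t [d [ad dy]]] := exists_adapted cy.
apply: (sec_smooth_coords (@findim_adapted R n m)).
  exact: (near_coords_adapted ac ad dy).
have dom q : adapted_dom t c d q -> jet_dom t c d (Psi q).
  by rewrite /jet_dom /= js_pt.
have sJ : msmooth_at (jet_coord t c d \o Psi) y.
  have sm := @js_smooth _ _ _ _ _ _ _ pi Psi t c d ac ad; apply: (smooth_fun_near sm).
  by apply: filterS (near_adapted_dom dy) => q; exact: dom.
apply: (msmooth_at_eq (g := fun q => (a, a *m (jet_coord t c d (Psi q)).2))).
  apply: filterS (near_adapted_dom dy) => q dq; have [_ cq _] := dq.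
  rewrite mdiff_adapted // -mdiff_proj // jet_lift_section mdiff_tvec //.
  have [dr er] := jet_rep_js q.
  by rewrite /jet_coord /= js_pt jacobian_section.
apply: msmooth_at_pair; first exact: msmooth_at_cst.
apply: msmooth_at_mulmx; first exact: msmooth_at_cst.
exact: (msmooth_at_snd sJ).
Qed.

Definition lift_of_jet : lifting pi := Lifting jet_lift_section jet_lift_smooth.

Lemma lift_of_jetE y (phi : local_section pi) : jet_set (Psi y) phi ->
  forall u, tangent_map phi (pi y) u = lift_of_jet y u.
Proof. by move=> /jet_mem[_ _]; rewrite js_pt. Qed.

End LiftOfJet.

Section JetOfLift.
Variable L : lifting pi.

Definition lift_rep y : local_section pi :=
  projT1 (cid (exists_section (lf_section L (y := y)))).

Lemma lift_repP y : [/\ ls_dom (lift_rep y) (pi y), lift_rep y (pi y) = y &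
  forall u, tangent_map (lift_rep y) (pi y) u = L y u].
Proof. by rewrite /lift_rep; case: cid. Qed.

Fact lift_jet_subproof y : exists phi : local_section pi,
  [/\ ls_dom phi (pi y), phi (pi y) = y &
    jet_class (pi y) (lift_rep y) = jet_class (pi y) phi].
Proof. by exists (lift_rep y); have [] := lift_repP y. Qed.

Definition lift_jet y : jet1 pi := Jet1 (lift_jet_subproof y).

Lemma lift_jetE y (phi : local_section pi) : jet_set (lift_jet y) phi ->
  [/\ ls_dom phi (pi y), phi (pi y) = y &
    forall u, tangent_map phi (pi y) u = L y u].
Proof.
have [d e h] := lift_repP y; case=> d' e' h'; split; [exact: d'|exact: (etrans e' e)|].
by move=> u; exact: (etrans (h' u) (h u)).
Qed.

Lemma lift_jet_rep y : [/\ ls_dom (jet_rep (lift_jet y)) (pi y),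
  jet_rep (lift_jet y) (pi y) = y &
  forall u, tangent_map (jet_rep (lift_jet y)) (pi y) u = L y u].
Proof.
apply: lift_jetE; have [d e ->] := jet_repP (lift_jet y).
by split; [exact: d|reflexivity|move=> v; reflexivity].
Qed.

(** Row i of the matrix of jet coordinates consists of the fibre components of the
lift of the i-th coordinate field. *)
Fact lift_jet_smooth (t : trivialization F pi) c d : atlas M c -> atlas F d ->
  smooth_fun (atlas E) (lift_jet @^-1` jet_dom t c d) (jet_coord t c d \o lift_jet).
Proof.
move=> ac ad; apply: msmooth_smooth_fun => y dy; have [ty cy ddy] := dy.
apply: msmooth_at_pair; first exact: msmooth_adapted.
apply: (msmooth_at_eq (g := fun q => \matrix_i
   (mdiff (d \o triv_fib t) (L q (tvec c (pi q) (delta_mx 0 i)) : tangent q)))).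
  apply: filterS (near_adapted_dom dy) => q dq; apply/row_matrixP => i.
  have [dr er h] := lift_jet_rep q.
  by rewrite rowK rowE jacobian_section // h.
apply: msmooth_at_mx => i j.
apply: (msmooth_at_ext (g := fun q =>
   mdiff (d \o triv_fib t) (L q (tvec c (pi q) (delta_mx 0 i)) : tangent q) 0 j : R^o)).
  by move=> q; rewrite mxE.
apply: msmooth_at_entry; apply: sec_smooth_mdiff; first exact: lf_smooth.
exact: (msmooth_fib ad dy).
Qed.

Fact lift_jet_section : @jet_pt _ _ _ _ _ _ _ pi \o lift_jet = id.
Proof. by []. Qed.

Definition jet_of_lift : jet_section pi :=
  JetSection lift_jet_smooth lift_jet_section.

End JetOfLift.

Lemma jet_of_liftK : cancel jet_of_lift lift_of_jet.
Proof. by move=> L; apply: lift_eq => y u; have [_ _] := lift_jet_rep L y. Qed.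

Lemma lift_of_jetK : cancel lift_of_jet jet_of_lift.
Proof.
move=> Psi; apply: js_eq => y; apply: jet_eq => [|u]; first by rewrite /= js_pt.
have [_ _ h] := lift_jet_rep (lift_of_jet Psi) y; exact: (h u).
Qed.

End Jets.

(** * The correspondences *)

Arguments subbundle_of_lift {R n m k M F E pi}.
Arguments lift_of_subbundle {R n m k M F E pi}.
Arguments form_of_lift {R n m k M F E pi}.
Arguments lift_of_form {R n m k M F E pi}.
Arguments jet_of_lift {R n m k M F E pi}.
Arguments lift_of_jet {R n m k M F E pi}.
Arguments subbundle_of_liftK {R n m k M F E pi}.
Arguments lift_of_subbundleK {R n m k M F E pi}.
Arguments form_of_liftK {R n m k M F E pi}.
Arguments lift_of_formK {R n m k M F E pi}.
Arguments jet_of_liftK {R n m k M F E pi}.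
Arguments lift_of_jetK {R n m k M F E pi}.

Theorem theorem1 (R : realType) (n m k : nat) (M : manifold R n)
    (F : manifold R m) (E : manifold R k) (pi : fiber_bundle M F E) :
  exists (subbundle_of_form : connection_form pi -> horizontal_subbundle pi)
         (form_of_subbundle : horizontal_subbundle pi -> connection_form pi)
         (subbundle_of_jet : jet_section pi -> horizontal_subbundle pi)
         (jet_of_subbundle : horizontal_subbundle pi -> jet_section pi)
         (form_of_jet : jet_section pi -> connection_form pi)
         (jet_of_form : connection_form pi -> jet_section pi),
    [/\ (* explicit descriptions *)
        [/\ forall (N : connection_form pi) (y : E) (v : tangent y),
              v \in subbundle_of_form N y <->
              exists X : vector_field E, N X y = v,
            forall (H : horizontal_subbundle pi) (X : vector_field E) (y : E),
              form_of_subbundle H X y \in H y /\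
              X y - form_of_subbundle H X y \in vertical pi y,
            forall (Psi : jet_section pi) (y : E) (phi : local_section pi),
              jet_set (Psi y) phi ->
              subbundle_of_jet Psi y = limg (tangent_map phi (pi y)) &
            forall (H : horizontal_subbundle pi) (y : E) (phi : local_section pi),
              jet_set (jet_of_subbundle H y) phi ->
              limg (tangent_map phi (pi y)) = H y],
        [/\ forall (Psi : jet_section pi) (X : vector_field E) (y : E)
                (phi : local_section pi),
              jet_set (Psi y) phi ->
              form_of_jet Psi X y
                = tangent_map phi (pi y) (tangent_map pi y (X y)) &
            forall (N : connection_form pi) (X : vector_field E) (y : E)
                (phi : local_section pi),
              jet_set (jet_of_form N y) phi ->
              tangent_map phi (pi y) (tangent_map pi y (X y)) = N X y],
        (* mutual inverses *)
        [/\ cancel subbundle_of_form form_of_subbundle,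
            cancel form_of_subbundle subbundle_of_form,
            cancel subbundle_of_jet jet_of_subbundle &
            cancel jet_of_subbundle subbundle_of_jet],
        cancel form_of_jet jet_of_form /\ cancel jet_of_form form_of_jet &
        (* compatibility of the three correspondences *)
        subbundle_of_form \o form_of_jet =1 subbundle_of_jet].
Proof.
exists (subbundle_of_lift \o lift_of_form),
  (form_of_lift \o lift_of_subbundle),
  (subbundle_of_lift \o lift_of_jet),
  (jet_of_lift \o lift_of_subbundle),
  (form_of_lift \o lift_of_jet),
  (jet_of_lift \o lift_of_form).
have limg_eq (A B : forall y, 'Hom(tangent (pi y), tangent y)) y :
    (forall u, A y u = B y u) -> limg (A y) = limg (B y).
  by move=> AB; congr (_ @: _)%VS; apply/lfunP.
split.
- split=> [N y v|H X y|Psi y phi /lift_of_jetE e|H y phi /lift_jetE[_ _ e]].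
  + split=> [/memv_imgP[u _ ->]|[X <-]].
      exists (field_through pi (lift_of_form N y u)).
      by rewrite -lift_of_formE field_throughE lf_section.
    by rewrite -lift_of_formE; apply: memv_img; exact: memvf.
  + by split; [exact: lift_of_subbundle_in|exact: lift_vertical].
  + apply: (limg_eq _ (fun _ => tangent_map phi _)) => u; exact/esym/e.
  + by rewrite -[in RHS](lift_of_subbundleK H); congr (_ @: _)%VS; apply/lfunP.
- split=> [Psi X y phi /lift_of_jetE e|N X y phi /lift_jetE[_ _ e]].
    by rewrite e.
  exact: (etrans (e _) (lift_of_formE N X y)).
- split.
  + exact: can_comp subbundle_of_liftK lift_of_formK.
  + exact: can_comp form_of_liftK lift_of_subbundleK.
  + exact: can_comp subbundle_of_liftK lift_of_jetK.
  + exact: can_comp jet_of_liftK lift_of_subbundleK.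
- split.
  + exact: can_comp form_of_liftK lift_of_jetK.
  + exact: can_comp jet_of_liftK lift_of_formK.
- by move=> Psi; rewrite /= form_of_liftK.
Qed.
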